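(* Consider system (5) in the standing setup with fixed $\sigma$ and weights, and suppose that the follower graph $\mathcal G^F_{\sigma(t)}$ is bidirectional for all $t\ge0$, i.e. for all $i,j\in\mathcal V_F$ and all $t\ge 0$, $(i,j)\in\mathcal E_{\sigma(t)}$ if and only if $(j,i)\in\mathcal E_{\sigma(t)}$ (the weights of $(i,j)$ and $(j,i)$ may differ). Then system (5) is SiISS with respect to $\mathcal L(y(t))$ if and only if $\mathcal G_{\sigma(t)}$ is jointly L-connected (JLC).
   Context: Standing setup. Fix integers $n\ge 2$, $k\ge 1$, $d\ge 1$. The follower set is $\mathcal V_F=\{1,\dots,n\}$ and the leader set is $\mathcal V_L=\{\hat 1,\dots,\hat k\}$ (disjoint from $\mathcal V_F$); $\mathcal V=\mathcal V_F\cup\mathcal V_L$. The interaction topology is a time-varying digraph $\mathcal G_{\sigma(t)}=(\mathcal V,\mathcal E_{\sigma(t)})$, where $\sigma:[0,\infty)\to\mathcal P$ is a piecewise constant switching signal taking values in a finite set $\mathcal P$ of digraphs on $\mathcal V$; no arc of any of these digraphs enters a leader. An arc $(j,i)$ means that $i$ receives information from $j$. Dwell-time assumption: any two consecutive switching instants of $\sigma$ are separated by at least $\tau_D>0$. For $i\in\mathcal V_F$, $N_i(\sigma(t))=\{j\in\mathcal V_F:(j,i)\in\mathcal E_{\sigma(t)}\}$ and $L_i(\sigma(t))=\{j\in\mathcal V_L:(j,i)\in\mathcal E_{\sigma(t)}\}$. $\mathcal G^F_{\sigma(t)}$ denotes the subgraph of $\mathcal G_{\sigma(t)}$ induced on $\mathcal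 V_F$. For $0\le t_1<t_2\le\infty$ the joint graph is $\mathcal G([t_1,t_2))=(\mathcal V,\bigcup_{t\in[t_1,t_2)}\mathcal E_{\sigma(t)})$, and $\mathcal G^F([t_1,t_2))$ is its subgraph induced on $\mathcal V_F$. System (5): $\dot y_i=u_i(y,t)$ for $i=1,\dots,k$, and $\dot x_i=\sum_{j\in N_i(\sigma(t))}a_{ij}(x,y,t)(x_j-x_i)+\sum_{j\in L_i(\sigma(t))}b_{ij}(x,y,t)(y_j-x_i)+w_i(t)$ for $i=1,\dots,n$, where $x_i,y_j\in\mathbb R^d$, $x=(x_1,\dots,x_n)$, $y=(y_1,\dots,y_k)$; each $u_i(y,t)$ is continuous in $y$ and piecewise continuous in $t$; each $w_i$ is continuous; the weights $a_{ij},b_{ij}$ are continuous and satisfy $a_*\le a_{ij}(x,y,t)\le a^*$, $b_{ij}(x,y,t)\ge b_*$ for all $x,y,t$, with constants $0<a_*\le a^*$, $b_*>0$. Initial time is $0$, $x^0=x(0)$, $y^0=y(0)$. Along a trajectory, $z(t)=(u_1(y(t),t),\dots,u_k(y(t),t),w_1(t),\dots,w_n(t))\in\mathbb R^{(n+k)d}$ and $\|z\|_\infty=\sup_{t\ge0}|z(t)|$. Set notation: $|\cdot|$ is the Euclidean norm; for a closed convex $K\subset\mathbb R^d$, $|v|_K=\inf_{p\in K}|v-p|$; $\mathcal L(y(t))=\mathrm{co}\{y_1(t),\dots,y_k(t)\}$ (convex hull); $|x(t)|_{\mathcal L(y(t))}=\max_{i\in\mathcal V_F}|x_i(t)|_{\mathcal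 L(y(t))}$. Connectivity: a digraph on $\mathcal V$ is L-connected if for every $i\in\mathcal V_F$ there is a directed path from some leader $j\in\mathcal V_L$ to $i$. $\mathcal G_{\sigma(t)}$ is jointly L-connected (JLC) if $\mathcal G([t,\infty))$ is L-connected for every $t\ge0$; it is uniformly jointly L-connected (UJLC) if there is $T>0$ such that $\mathcal G([t,t+T))$ is L-connected for every $t\ge0$. SiISS: system (5) is (globally, generalized) set integral-input-to-state stable with respect to $\mathcal L(y(t))$ if there exist a class-$\mathcal{KL}$ function $\beta$ and a class-$\mathcal K$ function $\gamma$ such that for all admissible $u_i,w_i$ and all initial conditions $x^0\in\mathbb R^{nd}$, $y^0\in\mathbb R^{kd}$: $|x(t)|_{\mathcal L(y(t))}\le\beta(|x^0|_{\mathcal L(y^0)},t)+\int_0^t\gamma(|z(s)|)\,ds$ for all $t\ge0$. *)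

(* Defs.v *)
From Stdlib Require Import Reals Lra Lia List Relations ClassicalEpsilon.
Open Scope R_scope.

(* A configuration of agents: agent index -> coordinate index -> R.
   Only agents i < (number of agents) and coordinates l < d are meaningful. *)
Definition Vecs := nat -> nat -> R.

(* Nodes: followers FN i (i < n) and leaders LN j (j < k), disjoint. *)
Inductive node := FN (i : nat) | LN (j : nat).

(* A digraph on nodes; G v w = true means arc (v,w): w receives info from v. *)
Definition digraph := node -> node -> bool.

Definition valid_node (n k : nat) (v : node) : Prop :=
  match v with FN i => (i < n)%nat | LN j => (j < k)%nat end.

Fixpoint sumR (m : nat) (f : nat -> R) : R :=
  match m with O => 0 | S m' => sumR m' f + f m' end.

Fixpoint maxR (m : nat) (f : nat -> R) : R :=
  match m with O => 0 | S m' => Rmax (maxR m' f) (f m') end.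

Definition vnorm (d : nat) (v : nat -> R) : R := sqrt (sumR d (fun l => (v l) ^ 2)).

Definition in_hull (k d : nat) (ys : Vecs) (p : nat -> R) : Prop :=
  exists lam : nat -> R,
    (forall j, (j < k)%nat -> 0 <= lam j) /\ sumR k lam = 1 /\
    forall l, (l < d)%nat -> p l = sumR k (fun j => lam j * ys j l).

Definition hull_dist (k d : nat) (ys : Vecs) (v : nat -> R) : R :=
  epsilon (inhabits 0) (fun r =>
    (forall p, in_hull k d ys p -> r <= vnorm d (fun l => v l - p l)) /\
    (forall r', (forall p, in_hull k d ys p -> r' <= vnorm d (fun l => v l - p l)) -> r' <= r)).

Definition set_dist (n k d : nat) (xs ys : Vecs) : R :=
  maxR n (fun i => hull_dist k d ys (xs i)).

Definition cont_nonneg (f : R -> R) : Prop :=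
  forall t eps, 0 <= t -> 0 < eps -> exists delta, 0 < delta /\
    forall s, 0 <= s -> Rabs (s - t) < delta -> Rabs (f s - f t) < eps.

Definition classK (g : R -> R) : Prop :=
  g 0 = 0 /\ (forall r s, 0 <= r -> r < s -> g r < g s) /\ cont_nonneg g.

Definition classKL (beta : R -> R -> R) : Prop :=
  (forall s, 0 <= s -> classK (fun r => beta r s)) /\
  (forall r, 0 <= r ->
     (forall s1 s2, 0 <= s1 -> s1 <= s2 -> beta r s2 <= beta r s1) /\
     (forall eps, 0 < eps -> exists T, forall s, T <= s -> beta r s < eps)).

Definition weight_continuous (n k d : nat) (f : Vecs -> Vecs -> R -> R) : Prop :=
  forall x y t eps, 0 < eps -> exists delta, 0 < delta /\
    forall x' y' t',
      (forall i l, (i < n)%nat -> (l < d)%nat -> Rabs (x' i l - x i l) < delta) ->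
      (forall j l, (j < k)%nat -> (l < d)%nat -> Rabs (y' j l - y j l) < delta) ->
      Rabs (t' - t) < delta -> Rabs (f x' y' t' - f x y t) < eps.

(* admissible leader input u_i(y,t) (values in R^d): continuous in y, and
   piecewise continuous in t: there is a partition 0 = r0 < r1 < ... -> oo such
   that on each R^{kd} x [r_m, r_{m+1}) u_i coincides with a function jointly
   continuous on R^{kd} x [r_m, r_{m+1}]. *)
Definition admissible_u (k d : nat) (ui : Vecs -> R -> nat -> R) : Prop :=
  (forall t l, 0 <= t -> (l < d)%nat -> forall y eps, 0 < eps -> exists delta, 0 < delta /\
     forall y', (forall j l', (j < k)%nat -> (l' < d)%nat -> Rabs (y' j l' - y j l') < delta) ->
       Rabs (ui y' t l - ui y t l) < eps) /\
  exists r : nat -> R, r O = 0 /\ (forall m, r m < r (S m)) /\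
    (forall T, exists m, T < r m) /\
    forall m, exists g : Vecs -> R -> nat -> R,
      (forall y t l, r m <= t < r (S m) -> g y t l = ui y t l) /\
      (forall l, (l < d)%nat -> forall y t eps, r m <= t <= r (S m) -> 0 < eps ->
         exists delta, 0 < delta /\ forall y' t', r m <= t' <= r (S m) ->
           (forall j l', (j < k)%nat -> (l' < d)%nat -> Rabs (y' j l' - y j l') < delta) ->
           Rabs (t' - t) < delta -> Rabs (g y' t' l - g y t l) < eps).

Definition admissible_w (n d : nat) (w : nat -> R -> nat -> R) : Prop :=
  forall i l, (i < n)%nat -> (l < d)%nat -> continuity (fun t => w i t l).

Definition locally_finite (D : R -> Prop) : Prop :=
  forall T, exists L : list R, forall t, D t -> t <= T -> In t L.

Definition follower_rhs (n k : nat) (sigma : R -> digraph)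
  (a b : nat -> nat -> Vecs -> Vecs -> R -> R) (w : nat -> R -> nat -> R)
  (x y : Vecs) (t : R) (i l : nat) : R :=
  sumR n (fun j => if sigma t (FN j) (FN i) then a i j x y t * (x j l - x i l) else 0)
  + sumR k (fun j => if sigma t (LN j) (FN i) then b i j x y t * (y j l - x i l) else 0)
  + w i t l.

Definition is_solution (n k d : nat) (sigma : R -> digraph)
  (a b : nat -> nat -> Vecs -> Vecs -> R -> R)
  (u : nat -> Vecs -> R -> nat -> R) (w : nat -> R -> nat -> R)
  (x y : R -> Vecs) : Prop :=
  (forall i l, (i < n)%nat -> (l < d)%nat -> cont_nonneg (fun s => x s i l)) /\
  (forall j l, (j < k)%nat -> (l < d)%nat -> cont_nonneg (fun s => y s j l)) /\
  exists D : R -> Prop, locally_finite D /\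
    forall t, 0 < t -> ~ D t ->
      (forall j l, (j < k)%nat -> (l < d)%nat ->
         derivable_pt_lim (fun s => y s j l) t (u j (y t) t l)) /\
      (forall i l, (i < n)%nat -> (l < d)%nat ->
         derivable_pt_lim (fun s => x s i l) t
           (follower_rhs n k sigma a b w (x t) (y t) t i l)).

Definition znorm (n k d : nat) (u : nat -> Vecs -> R -> nat -> R)
  (w : nat -> R -> nat -> R) (y : R -> Vecs) (t : R) : R :=
  sqrt (sumR k (fun j => sumR d (fun l => (u j (y t) t l) ^ 2))
        + sumR n (fun i => sumR d (fun l => (w i t l) ^ 2))).

Definition SiISS (n k d : nat) (sigma : R -> digraph)
  (a b : nat -> nat -> Vecs -> Vecs -> R -> R) : Prop :=
  exists (beta : R -> R -> R) (gamma : R -> R), classKL beta /\ classK gamma /\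
    forall (u : nat -> Vecs -> R -> nat -> R) (w : nat -> R -> nat -> R) (x y : R -> Vecs),
      (forall j, (j < k)%nat -> admissible_u k d (u j)) ->
      admissible_w n d w ->
      is_solution n k d sigma a b u w x y ->
      forall t (Ht : 0 <= t)
        (pr : Riemann_integrable (fun s => gamma (znorm n k d u w y s)) 0 t),
        set_dist n k d (x t) (y t) <= beta (set_dist n k d (x 0) (y 0)) t + RiemannInt pr.

Definition joint_arc (n k : nat) (sigma : R -> digraph) (I : R -> Prop) (v w : node) : Prop :=
  valid_node n k v /\ valid_node n k w /\ exists s, I s /\ sigma s v w = true.

Definition L_connected (n k : nat) (E : node -> node -> Prop) : Prop :=
  forall i, (i < n)%nat -> exists j, (j < k)%nat /\ clos_trans node E (LN j) (FN i).

Definition JLC (n k : nat) (sigma : R -> digraph) : Prop :=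
  forall t, 0 <= t -> L_connected n k (joint_arc n k sigma (fun s => t <= s)).

Definition dwell_time (sigma : R -> digraph) (tauD : R) : Prop :=
  0 < tauD /\ exists s : nat -> R, s O = 0 /\ (forall m, s m + tauD <= s (S m)) /\
    forall m t, s m <= t < s (S m) -> sigma t = sigma (s m).

(* Main.v *)
(** If the joint graph is connected, fix a unit vector [v] and put
    [X_i = v . x_i - max_j v . y_j(0) - G], where [G] is the integral of [|z|].
    Leaders and inputs drop out and
    [X_i' <= sum_j a_ij (X_j - X_i) - B_i X_i], with [B_i] bounded below when a
    leader is heard.  Let [S] be the set of followers known to lie a fixed fraction
    below the maximum.  Because follower arcs are bidirectional, either [S] exchanges
    nothing with its complement, and its maximum does not increase, or some follower
    joins [S] during one dwell interval at the price of a constant factor.  Joint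
    connectivity makes the second case recur until [S] is everything, so the maximum
    contracts by a fixed factor over windows that depend on the switching signal only;
    the distance to the hull is recovered as a supremum over [v].

    Conversely, if the set [U] of followers is cut off from the leaders after a
    switching time [t0], then, by bidirectionality, putting [U] at a point at distance
    [r] and everybody else, leaders included, at the origin gives an equilibrium for
    [t >= t0].  The weights are only continuous, so instead of solving the equation
    backward from [t0] one builds an approximate solution whose defect is
    continuous and arbitrarily small: this defect is an admissible disturbance, whose
    cost cannot pay for the distance [r] that persists forever. *)

Require Import Defs.
From Stdlib Require Import Reals List Lra Lia Relations Classical ClassicalEpsilon.
From Coquelicot Require Import Coquelicot.
Open Scope R_scope.

(** Projections are used because the distance to a moving hull need not be differentiable, while a
    fixed direction gives a linear differential inequality whose constants depend on neither the
    direction nor the inputs. Leader weights have no upper bound, so the leader term may only be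
    dropped or bounded from one side, and only where [X_i] is nonnegative; barriers are therefore
    kept nonnegative and tested only where exceeded. Joint connectivity bounds no waiting time. What
    stays uniform is the contraction factor, one power of a fixed rate per follower; the time
    dependence of [beta] comes from an infimum over admissible constants. In the converse, time
    starts at 0 but the equilibrium exists only from [t0] on. The disturbance must be continuous
    across switching instants, so each piece of the approximate solution is built with a prescribed
    terminal defect. The level [r] is fixed before the tolerance, small enough that the backward
    motion stays in a box on which the continuous weights are bounded; only afterwards is the defect
    made small relative to [gamma]. *)

(** * Finite sums *)

Lemma sumR_ext m f g :
  (forall i, (i < m)%nat -> f i = g i) -> sumR m f = sumR m g.
Proof.
  induction m as [|m IH]; simpl; intros H; [reflexivity|].
  rewrite (H m) by lia. rewrite IH; [reflexivity|]. intros; apply H; lia.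
Qed.

Lemma sumR_le m f g :
  (forall i, (i < m)%nat -> f i <= g i) -> sumR m f <= sumR m g.
Proof.
  induction m as [|m IH]; simpl; intros H; [lra|].
  apply Rplus_le_compat; [apply IH; intros|]; apply H; lia.
Qed.

Lemma sumR_const m c : sumR m (fun _ => c) = INR m * c.
Proof.
  induction m as [|m IH]; [simpl; lra|].
  rewrite S_INR. change (sumR m (fun _ => c) + c = (INR m + 1) * c).
  rewrite IH; lra.
Qed.

Lemma sumR_plus m f g : sumR m (fun i => f i + g i) = sumR m f + sumR m g.
Proof. induction m as [|m IH]; simpl; [lra|rewrite IH; lra]. Qed.

Lemma sumR_scal m c f : sumR m (fun i => c * f i) = c * sumR m f.
Proof. induction m as [|m IH]; simpl; [lra|rewrite IH; lra]. Qed.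

Lemma sumR_opp m f : sumR m (fun i => - f i) = - sumR m f.
Proof. induction m as [|m IH]; simpl; [lra|rewrite IH; lra]. Qed.

Lemma sumR_swap m p (f : nat -> nat -> R) :
  sumR m (fun i => sumR p (fun j => f i j)) = sumR p (fun j => sumR m (fun i => f i j)).
Proof.
  induction m as [|m IH]; simpl.
  - symmetry. rewrite sumR_const. lra.
  - rewrite IH, sumR_plus. reflexivity.
Qed.

Lemma sumR_zero m f : (forall i, (i < m)%nat -> f i = 0) -> sumR m f = 0.
Proof. intros H. rewrite (sumR_ext _ _ (fun _ => 0) H), sumR_const. lra. Qed.

Lemma sumR_nonneg m f : (forall i, (i < m)%nat -> 0 <= f i) -> 0 <= sumR m f.
Proof.
  intros H. rewrite <- (sumR_zero m (fun _ => 0)) by reflexivity.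
  now apply sumR_le.
Qed.

Lemma sumR_ge_term m f i :
  (forall j, (j < m)%nat -> 0 <= f j) -> (i < m)%nat -> f i <= sumR m f.
Proof.
  induction m as [|m IH]; intros H Hi; [lia|]. simpl.
  pose proof (H m ltac:(lia)).
  assert (0 <= sumR m f) by (apply sumR_nonneg; intros; apply H; lia).
  destruct (Nat.eq_dec i m) as [->|]; [lra|].
  assert (f i <= sumR m f) by (apply IH; [intros; apply H|]; lia). lra.
Qed.

Lemma sumR_abs m f : Rabs (sumR m f) <= sumR m (fun i => Rabs (f i)).
Proof.
  induction m as [|m IH]; simpl; [rewrite Rabs_R0; lra|].
  eapply Rle_trans; [apply Rabs_triang|lra].
Qed.

Lemma sumR_single m f i :
  (i < m)%nat -> (forall j, (j < m)%nat -> j <> i -> f j = 0) -> sumR m f = f i.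
Proof.
  induction m as [|m IH]; intros Hi H; [lia|]. simpl.
  destruct (Nat.eq_dec i m) as [->|Hne].
  - rewrite sumR_zero; [lra|]. intros; apply H; lia.
  - rewrite IH, (H m); [lra|lia|lia|lia|]. intros; apply H; lia.
Qed.

(** Cauchy-Schwarz against the constant vector. The auxiliary [K] spreads the cross term over the
    summands by [(f p - z)^2 >= 0], so the induction adds one square at a time. *)
Lemma sumR_pow2_le m f : (sumR m f) ^ 2 <= INR m * sumR m (fun i => f i ^ 2).
Proof.
  assert (K : forall z p, 2 * sumR p f * z <= sumR p (fun i => f i ^ 2) + INR p * z ^ 2).
  { intros z p. induction p as [|p IH]; [simpl; lra|]. rewrite S_INR. cbn [sumR].
    pose proof (pow2_ge_0 (f p - z)). nra. }
  induction m as [|m IH]; [simpl; lra|]. rewrite S_INR. cbn [sumR].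
  pose proof (K (f m) m). nra.
Qed.

Lemma derivable_pt_lim_sumR m (f : nat -> R -> R) df t :
  (forall i, (i < m)%nat -> derivable_pt_lim (f i) t (df i)) ->
  derivable_pt_lim (fun s => sumR m (fun i => f i s)) t (sumR m df).
Proof.
  induction m as [|m IH]; simpl; intros H.
  - apply derivable_pt_lim_const.
  - apply (derivable_pt_lim_plus (fun s => sumR m (fun i => f i s)) (f m)).
    + apply IH; intros; apply H; lia.
    + apply H; lia.
Qed.

Lemma continuity_pt_sumR m (f : nat -> R -> R) t :
  (forall i, (i < m)%nat -> continuity_pt (f i) t) ->
  continuity_pt (fun s => sumR m (fun i => f i s)) t.
Proof.
  induction m as [|m IH]; simpl; intros H.
  - apply continuity_pt_const. intros x y; reflexivity.
  - apply (continuity_pt_plus (fun s => sumR m (fun i => f i s)) (f m)).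
    + apply IH; intros; apply H; lia.
    + apply H; lia.
Qed.

Lemma finite_bound m (Q : nat -> R -> Prop) :
  (forall i B B', B <= B' -> Q i B -> Q i B') ->
  (forall i, (i < m)%nat -> exists B, Q i B) ->
  exists B, forall i, (i < m)%nat -> Q i B.
Proof.
  intros Hmono. induction m as [|m IH]; intros H.
  - exists 0; intros; lia.
  - destruct IH as [B HB]; [intros; apply H; lia|].
    destruct (H m) as [B' HB']; [lia|].
    exists (Rmax B B'). intros i Hi.
    destruct (Nat.eq_dec i m) as [->|].
    + eapply Hmono; [apply Rmax_r|exact HB'].
    + eapply Hmono; [apply Rmax_l|apply HB; lia].
Qed.

(** * Pointwise continuity and derivatives, gluing, monotonicity *)

Lemma continuity_pt_eps f t :
  continuity_pt f t <->
  forall eps, 0 < eps -> exists delta, 0 < delta /\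
    forall s, Rabs (s - t) < delta -> Rabs (f s - f t) < eps.
Proof.
  split.
  - intros H eps He. destruct (H eps He) as [d [Hd Hs]]. exists d; split; [exact Hd|].
    intros s Hst. destruct (Req_dec t s) as [->|Hne].
    + rewrite Rminus_diag, Rabs_R0; exact He.
    + apply Hs. split; [split; [exact I|exact Hne]|exact Hst].
  - intros H eps He. destruct (H eps He) as [d [Hd Hs]]. exists d; split; [exact Hd|].
    intros s [_ Hst]. apply Hs, Hst.
Qed.

Lemma continuity_pt_local f g t r :
  0 < r -> (forall s, Rabs (s - t) < r -> f s = g s) ->
  continuity_pt f t -> continuity_pt g t.
Proof.
  intros Hr E H. apply continuity_pt_eps. intros eps He.
  destruct (proj1 (continuity_pt_eps f t) H eps He) as [d [Hd Hs]].
  exists (Rmin d r). split; [now apply Rmin_pos|]. intros s Hst.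
  rewrite <- !E.
  - apply Hs. eapply Rlt_le_trans; [exact Hst|apply Rmin_l].
  - rewrite Rminus_diag, Rabs_R0; exact Hr.
  - eapply Rlt_le_trans; [exact Hst|apply Rmin_r].
Qed.

Lemma derivable_pt_lim_local f g t r l :
  0 < r -> (forall s, Rabs (s - t) < r -> f s = g s) ->
  derivable_pt_lim f t l -> derivable_pt_lim g t l.
Proof.
  intros Hr E H eps He. destruct (H eps He) as [d Hd].
  assert (Hm : 0 < Rmin d r) by (apply Rmin_pos; [apply cond_pos|exact Hr]).
  exists (mkposreal _ Hm). simpl. intros h Hh Hlt.
  rewrite <- !E.
  - apply Hd; [exact Hh|]. eapply Rlt_le_trans; [exact Hlt|apply Rmin_l].
  - rewrite Rminus_diag, Rabs_R0; exact Hr.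
  - replace (t + h - t) with h by ring.
    eapply Rlt_le_trans; [exact Hlt|apply Rmin_r].
Qed.

Lemma continuity_glue f g c :
  continuity f -> continuity g -> f c = g c ->
  continuity (fun t => if Rle_dec t c then f t else g t).
Proof.
  intros Hf Hg E t.
  destruct (Rtotal_order t c) as [Hlt|[->|Hgt]].
  - apply (continuity_pt_local f _ t (c - t)); [lra| |apply Hf].
    intros s Hs. apply Rabs_def2 in Hs. destruct (Rle_dec s c); lra.
  - apply continuity_pt_eps. intros eps He.
    destruct (proj1 (continuity_pt_eps f c) (Hf c) eps He) as [d1 [Hd1 H1]].
    destruct (proj1 (continuity_pt_eps g c) (Hg c) eps He) as [d2 [Hd2 H2]].
    exists (Rmin d1 d2). split; [now apply Rmin_pos|]. intros s Hs.
    destruct (Rle_dec c c) as [_|]; [|lra].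
    destruct (Rle_dec s c).
    + apply H1. eapply Rlt_le_trans; [exact Hs|apply Rmin_l].
    + rewrite E. apply H2. eapply Rlt_le_trans; [exact Hs|apply Rmin_r].
  - apply (continuity_pt_local g _ t (t - c)); [lra| |apply Hg].
    intros s Hs. apply Rabs_def2 in Hs. destruct (Rle_dec s c); lra.
Qed.

(** Switching instants and input jumps enter through the finite list [L]: the induction cuts the
    interval at each listed point inside it, and continuity joins the pieces. Without listed points
    this is the mean value theorem, with a derivative picked by [epsilon]. *)
Lemma nonincreasing_except (L : list R) (f : R -> R) : forall p q, p <= q ->
  (forall t, p <= t <= q -> continuity_pt f t) ->
  (forall t, p < t < q -> ~ In t L -> exists l, derivable_pt_lim f t l /\ l <= 0) ->
  f q <= f p.
Proof.
  induction L as [|c L IH]; intros p q Hpq Hc Hd.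
  - destruct (Req_dec p q) as [->|Hne]; [lra|].
    assert (Hd' : forall t, p < t < q -> exists l, derivable_pt_lim f t l /\ l <= 0)
      by (intros t Ht; apply Hd; auto).
    set (Q := fun t l => (p < t < q -> derivable_pt_lim f t l) /\ l <= 0).
    set (df := fun t => epsilon (inhabits 0) (Q t)).
    assert (Hdf : forall t, Q t (df t)).
    { intros t. apply epsilon_spec.
      destruct (classic (p < t < q)) as [Ht|Ht].
      - destruct (Hd' t Ht) as [l [H1 H2]]. exists l. split; auto.
      - exists 0. split; [tauto|lra]. }
    destruct (MVT_gen f p q df) as [x [Hx E]].
    + rewrite Rmin_left, Rmax_right by lra. intros t Ht.
      apply is_derive_Reals, (proj1 (Hdf t)), Ht.
    + rewrite Rmin_left, Rmax_right by lra. exact Hc.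
    + pose proof (proj2 (Hdf x)). nra.
  - destruct (Rle_dec c p) as [Hcp|Hcp]; [|destruct (Rle_dec q c) as [Hcq|Hcq]].
    1,2: apply IH; auto; intros t Ht Hn; apply Hd; auto; intros [->|]; auto; lra.
    apply Rle_trans with (f c).
    all: apply IH; [lra|intros; apply Hc; lra|].
    all: intros t Ht Hn; apply Hd; [lra|intros [->|]; auto; lra].
Qed.

(** * Scalar differential inequalities *)

(** Squaring removes the corner of the positive part at 0, so the chain rule applies even where a
    function changes sign. *)
Lemma derivable_pt_lim_pospart_sqr x :
  derivable_pt_lim (fun r => Rmax r 0 ^ 2) x (2 * Rmax x 0).
Proof.
  destruct (Rtotal_order x 0) as [Hx|[->|Hx]].
  - rewrite Rmax_right by lra. replace (2 * 0) with 0 by ring.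
    apply (derivable_pt_lim_local (fun _ => 0) _ x (- x)); [lra| |apply derivable_pt_lim_const].
    intros s Hs. apply Rabs_def2 in Hs. rewrite Rmax_right by lra. ring.
  - rewrite Rmax_right by lra. intros eps He.
    exists (mkposreal eps He). simpl. intros h Hh Hlt.
    rewrite Rplus_0_l, (Rmax_right 0 0) by lra.
    replace ((Rmax h 0 * (Rmax h 0 * 1) - 0 * (0 * 1)) / h - 2 * 0)
      with (Rmax h 0 * Rmax h 0 / h) by (field; exact Hh).
    destruct (Rle_dec 0 h).
    + rewrite Rmax_left by lra. replace (h * h / h) with h by (field; exact Hh). exact Hlt.
    + rewrite Rmax_right by lra. replace (0 * 0 / h) with 0 by (field; exact Hh).
      rewrite Rabs_R0. exact He.
  - rewrite Rmax_left by lra.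
    apply (derivable_pt_lim_local (fun r => r ^ 2) _ x x); [lra| |].
    + intros s Hs. apply Rabs_def2 in Hs. rewrite Rmax_left by lra. reflexivity.
    + apply is_derive_Reals. auto_derive; auto. ring.
Qed.

Lemma derivable_pt_lim_exp_scal c t :
  derivable_pt_lim (fun s => exp (c * s)) t (c * exp (c * t)).
Proof. apply is_derive_Reals. auto_derive; auto; ring. Qed.

(* Gronwall for the sum of the squared positive parts. *)
Lemma comparison N (f : nat -> R -> R) K L p q :
  0 <= K -> p <= q ->
  (forall i, (i < N)%nat -> continuity (f i)) ->
  (forall t, p < t < q -> ~ In t L -> forall i, (i < N)%nat ->
     exists l, derivable_pt_lim (f i) t l /\
       (0 < f i t -> l <= K * sumR N (fun j => Rmax (f j t) 0))) ->
  (forall i, (i < N)%nat -> f i p <= 0) ->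
  forall i, (i < N)%nat -> f i q <= 0.
Proof.
  intros HK Hpq Hc Hd H0 i Hi.
  set (V := fun t => sumR N (fun i => Rmax (f i t) 0 ^ 2)).
  (* With [P] the sum of positive parts, [V' <= 2 * K * P^2], and Cauchy-Schwarz gives
     [P^2 <= INR N * V]; hence this exponent. *)
  set (C := 2 * K * INR N).
  assert (HVq : V q * exp (- C * q) <= V p * exp (- C * p)).
  { apply (nonincreasing_except L (fun t => V t * exp (- C * t)) p q Hpq).
    - intros t Ht.
      apply (continuity_pt_mult V (fun t => exp (- C * t))).
      + apply (continuity_pt_sumR N (fun i t => Rmax (f i t) 0 ^ 2)).
        intros j Hj.
        apply (continuity_pt_comp (f j) (fun r => Rmax r 0 ^ 2)); [apply Hc, Hj|].
        apply derivable_continuous_pt. eexists. apply derivable_pt_lim_pospart_sqr.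
      + apply derivable_continuous_pt. eexists. apply derivable_pt_lim_exp_scal.
    - intros t Ht HL.
      set (Q := fun i l => derivable_pt_lim (f i) t l /\
        (0 < f i t -> l <= K * sumR N (fun j => Rmax (f j t) 0))).
      set (df := fun i => epsilon (inhabits 0) (Q i)).
      assert (Hdf : forall i, (i < N)%nat -> Q i (df i))
        by (intros j Hj; apply epsilon_spec, (Hd t Ht HL j Hj)).
      exists (sumR N (fun i => 2 * Rmax (f i t) 0 * df i) * exp (- C * t)
              + V t * (- C * exp (- C * t))).
      split.
      + apply (derivable_pt_lim_mult V (fun t => exp (- C * t))).
        * apply (derivable_pt_lim_sumR N (fun i t => Rmax (f i t) 0 ^ 2)
                   (fun i => 2 * Rmax (f i t) 0 * df i)).
          intros j Hj.
          apply (derivable_pt_lim_comp (f j) (fun r => Rmax r 0 ^ 2));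
            [apply (Hdf j Hj)|apply derivable_pt_lim_pospart_sqr].
        * apply derivable_pt_lim_exp_scal.
      + set (P := sumR N (fun j => Rmax (f j t) 0)).
        assert (HP : 0 <= P) by (apply sumR_nonneg; intros; apply Rmax_r).
        assert (H1 : sumR N (fun i => 2 * Rmax (f i t) 0 * df i) <= 2 * K * P * P).
        { unfold P at 2. rewrite <- sumR_scal. apply sumR_le. intros j Hj.
          destruct (Hdf j Hj) as [_ Hj2]. fold P in Hj2.
          destruct (Rlt_dec 0 (f j t)) as [Hpos|Hneg].
          - rewrite Rmax_left by lra. specialize (Hj2 Hpos). nra.
          - rewrite Rmax_right by lra. lra. }
        pose proof (sumR_pow2_le N (fun j => Rmax (f j t) 0)) as H2. fold P in H2.
        change (P ^ 2 <= INR N * V t) in H2.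
        pose proof (exp_pos (- C * t)) as He.
        assert (H3 : 2 * K * P * P <= C * V t) by (unfold C; nra).
        nra. }
  assert (HVp : V p = 0).
  { apply sumR_zero. intros j Hj. rewrite Rmax_right by (apply H0, Hj). ring. }
  rewrite HVp in HVq. pose proof (exp_pos (- C * q)).
  assert (HV : V q <= 0) by nra.
  assert (Rmax (f i q) 0 ^ 2 <= V q).
  { apply (sumR_ge_term N (fun i => Rmax (f i q) 0 ^ 2)); [intros; apply pow2_ge_0|exact Hi]. }
  destruct (Rle_dec (f i q) 0); [assumption|].
  rewrite Rmax_left in * by lra. nra.
Qed.

(** The case of one function and [K = 0]: a comparison function needs checking only where it has
    been exceeded. *)
Lemma barrier (f : R -> R) L p q :
  p <= q -> continuity f ->
  (forall t, p < t < q -> ~ In t L ->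
     exists l, derivable_pt_lim f t l /\ (0 < f t -> l <= 0)) ->
  f p <= 0 -> f q <= 0.
Proof.
  intros Hpq Hc Hd H0.
  apply (comparison 1 (fun _ => f) 0 L p q) with (i := 0%nat); auto with real.
  intros t Ht HL i _. destruct (Hd t Ht HL) as [l [H1 H2]].
  exists l. split; [exact H1|]. intros H. rewrite Rmult_0_l. auto.
Qed.

(* The scalar quantities controlled along a trajectory: projections of the
   followers on a direction, shifted so that leaders and inputs drop out. *)
Definition subsolution (n k : nat) (sigma : R -> digraph) (a_lo a_hi b_lo T : R)
  (X : nat -> R -> R) : Prop :=
  (forall i, (i < n)%nat -> continuity (X i)) /\
  exists L : list R, forall t, 0 < t < T -> ~ In t L -> forall i, (i < n)%nat ->
    exists l alpha beta, derivable_pt_lim (X i) t l /\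
      (forall j, (j < n)%nat -> if sigma t (FN j) (FN i)
         then a_lo <= alpha j <= a_hi else alpha j = 0) /\
      0 <= beta /\
      (forall j, (j < k)%nat -> sigma t (LN j) (FN i) = true -> b_lo <= beta) /\
      l <= sumR n (fun j => alpha j * (X j t - X i t)) - beta * X i t.

(** Where [X i > m], a term [alpha j * (X j - X i)] is at most [a_hi] times the positive excess of
    [X j] over [m]; arcs from outside [S] are absent, and the leader term is nonpositive since
    [m >= 0]. The excesses thus satisfy the hypothesis of [comparison]. *)
Lemma subsolution_closed n k sigma a_lo a_hi b_lo T X (S : nat -> Prop) p q m :
  0 < a_lo -> a_lo <= a_hi ->
  subsolution n k sigma a_lo a_hi b_lo T X ->
  0 <= p -> p <= q -> q <= T -> 0 <= m ->
  (forall t i j, p < t < q -> (i < n)%nat -> (j < n)%nat -> S i -> ~ S j ->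
     sigma t (FN j) (FN i) = false) ->
  (forall i, (i < n)%nat -> S i -> X i p <= m) ->
  forall i, (i < n)%nat -> S i -> X i q <= m.
Proof.
  intros Ha Hah [Hc [L Hd]] Hp Hpq HqT Hm HS H0 i Hi HSi.
  (* Followers outside [S] get a negative constant, so they drop out of the sum of positive
     parts. *)
  set (f := fun i t => if excluded_middle_informative (S i) then X i t - m else -1).
  assert (Hf : f i q <= 0).
  { apply (comparison n f a_hi L p q); auto; [lra| | |].
    - intros j Hj. unfold f. destruct (excluded_middle_informative (S j)).
      + apply (continuity_minus (X j) (fun _ => m)); [apply Hc, Hj|].
        apply continuity_const. intros x y; reflexivity.
      + apply continuity_const. intros x y; reflexivity.
    - intros t Ht HL j Hj. unfold f at 1 2.
      destruct (excluded_middle_informative (S j)) as [HSj|HSj].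
      + destruct (Hd t ltac:(lra) HL j Hj) as (l & al & be & Hl & Hal & Hbe & _ & Hle).
        exists (l - 0). split.
        * apply (derivable_pt_lim_minus (X j) (fun _ => m)); [exact Hl|apply derivable_pt_lim_const].
        * intros Hpos.
          assert (sumR n (fun j0 => al j0 * (X j0 t - X j t))
                  <= a_hi * sumR n (fun j0 => Rmax (f j0 t) 0)).
          { rewrite <- sumR_scal. apply sumR_le. intros j' Hj'.
            specialize (Hal j' Hj'). unfold f.
            destruct (excluded_middle_informative (S j')) as [HSj'|HSj'].
            - pose proof (Rmax_l (X j' t - m) 0). pose proof (Rmax_r (X j' t - m) 0).
              destruct (sigma t (FN j') (FN j)).
              + apply Rle_trans with (al j' * Rmax (X j' t - m) 0).
                * apply Rmult_le_compat_l; lra.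
                * apply Rmult_le_compat_r; lra.
              + rewrite Hal. nra.
            - rewrite (HS t j j' Ht Hj Hj' HSj HSj') in Hal. rewrite Hal.
              rewrite Rmax_right by lra. lra. }
          assert (0 <= be * X j t) by (apply Rmult_le_pos; lra). lra.
      + exists 0. split; [apply derivable_pt_lim_const|]. intros; lra.
    - intros j Hj. unfold f. destruct (excluded_middle_informative (S j)); [|lra].
      specialize (H0 j Hj s). lra. }
  unfold f in Hf. destruct (excluded_middle_informative (S i)); [lra|tauto].
Qed.

Lemma subsolution_max n k sigma a_lo a_hi b_lo T X p q m :
  0 < a_lo -> a_lo <= a_hi ->
  subsolution n k sigma a_lo a_hi b_lo T X ->
  0 <= p -> p <= q -> q <= T -> 0 <= m ->
  (forall i, (i < n)%nat -> X i p <= m) ->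
  forall i, (i < n)%nat -> X i q <= m.
Proof.
  intros Ha Hah Hs Hp Hpq HqT Hm H0 i Hi.
  apply (subsolution_closed n k sigma a_lo a_hi b_lo T X (fun _ => True) p q m); auto.
  intros t i' j _ _ _ _ H. tauto.
Qed.

(** With all neighbours at most at [M], the gap [M - X i] shrinks at rate at most [INR n * a_hi].
    The exponential barrier is nonnegative, so above it the leader term only helps. *)
Lemma subsolution_decay n k sigma a_lo a_hi b_lo T X p q M eta i :
  0 < a_lo -> a_lo <= a_hi ->
  subsolution n k sigma a_lo a_hi b_lo T X ->
  0 <= p -> p <= q -> q <= T -> 0 <= M -> 0 <= eta <= 1 ->
  (forall j, (j < n)%nat -> X j p <= M) ->
  (i < n)%nat -> X i p <= (1 - eta) * M ->
  X i q <= (1 - eta * exp (- (INR n * a_hi) * (q - p))) * M.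
Proof.
  intros Ha Hah Hs Hp Hpq HqT HM Heta H0 Hi Hip.
  set (K := INR n * a_hi).
  assert (HK : 0 <= K) by (apply Rmult_le_pos; [apply pos_INR|lra]).
  set (f := fun t => X i t - (M - eta * M * (exp (K * p) * exp (- K * t)))).
  assert (E : forall t, exp (K * p) * exp (- K * t) = exp (- K * (t - p)))
    by (intros t; rewrite <- exp_plus; f_equal; ring).
  assert (Hf : f q <= 0).
  { destruct Hs as [Hc [L Hd]].
    apply (barrier f L p q Hpq).
    - apply (continuity_minus (X i)); [apply Hc, Hi|].
      intros t. apply derivable_continuous_pt.
      exists (- (eta * M * (exp (K * p) * (- K * exp (- K * t))))).
      apply is_derive_Reals. auto_derive; auto. ring.
    - intros t Ht HL.
      destruct (Hd t ltac:(lra) HL i Hi) as (l & al & be & Hl & Hal & Hbe & _ & Hle).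
      exists (l - (- (eta * M * (exp (K * p) * (- K * exp (- K * t)))))). split.
      + apply (derivable_pt_lim_minus (X i)
          (fun t => M - eta * M * (exp (K * p) * exp (- K * t)))); [exact Hl|].
        apply is_derive_Reals. auto_derive; auto. ring.
      + unfold f. intros Hpos.
        assert (Hexp : 0 < exp (- K * (t - p)) <= 1).
        { split; [apply exp_pos|]. rewrite <- exp_0. 
          destruct (Rle_lt_or_eq_dec (- K * (t - p)) 0) as [H|H]; [nra| |].
          - left. now apply exp_increasing.
          - rewrite H. lra. }
        rewrite E in Hpos.
        replace (exp (K * p) * (- K * exp (- K * t))) with (- K * exp (- K * (t - p)))
          by (rewrite <- E; ring).
        set (x := exp (- K * (t - p))) in *.
        assert (Hmax : forall j, (j < n)%nat -> X j t <= M).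
        { apply (subsolution_max n k sigma a_lo a_hi b_lo T X p t M); auto; try lra.
          split; [exact Hc|exists L; exact Hd]. }
        assert (Hex : eta * M * x <= M).
        { assert (eta * x <= 1) by nra. nra. }
        assert (Hsum : sumR n (fun j => al j * (X j t - X i t)) <= K * (M - X i t)).
        { unfold K. rewrite Rmult_assoc, <- sumR_const. apply sumR_le. intros j Hj.
          specialize (Hal j Hj). specialize (Hmax j Hj) as Hj'. pose proof (Hmax i Hi).
          destruct (sigma t (FN j) (FN i)).
          - apply Rle_trans with (al j * (M - X i t)).
            + apply Rmult_le_compat_l; lra.
            + apply Rmult_le_compat_r; lra.
          - rewrite Hal. assert (0 <= a_hi * (M - X i t)) by (apply Rmult_le_pos; lra). lra. }
        assert (0 <= be * X i t) by (apply Rmult_le_pos; lra).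
        assert (K * (M - X i t) <= K * (eta * M * x)) by (apply Rmult_le_compat_l; lra).
        nra.
    - unfold f. rewrite E. replace (- K * (p - p)) with 0 by ring. rewrite exp_0. lra. }
  unfold f in Hf. rewrite E in Hf. unfold K in *. lra.
Qed.

(** A linear barrier descends from [M] with slope [- c * M]. Hearing a leader or a follower at the
    lower level contributes a downward rate [g * eta * M], against an upward pull of at most
    [K * (M - X j)], which is small while [X j] is near [M]. *)
Lemma subsolution_gain n k sigma a_lo a_hi b_lo T X p q M eta g Delta j :
  0 < a_lo -> a_lo <= a_hi -> 0 < g -> g <= a_lo -> g <= b_lo ->
  subsolution n k sigma a_lo a_hi b_lo T X ->
  0 <= p -> p <= q -> q <= T -> q - p <= Delta -> 0 <= M -> 0 <= eta <= 1 ->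
  (forall i, (i < n)%nat -> X i p <= M) ->
  (j < n)%nat ->
  (forall t, p < t < q ->
     (exists i, (i < n)%nat /\ sigma t (FN i) (FN j) = true /\ X i t <= (1 - eta) * M) \/
     (exists i, (i < k)%nat /\ sigma t (LN i) (FN j) = true)) ->
  X j q <= (1 - g * eta * (q - p) / (1 + Delta * (INR n * a_hi + g))) * M.
Proof.
  intros Ha Hah Hg Hga Hgb Hs Hp Hpq HqT HD HM Heta H0 Hj Harc.
  (* The summand [g] comes from the leader case, where [- g * X j = g * (M - X j) - g * M]. *)
  set (K := INR n * a_hi + g).
  assert (HKn : 0 <= INR n * a_hi) by (apply Rmult_le_pos; [apply pos_INR|lra]).
  assert (HK : 0 < K) by (unfold K; lra).
  assert (HDK : 0 <= Delta * K) by (apply Rmult_le_pos; lra).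
  (* Above the barrier [M - X j] is below [c * M * Delta], and [c * (1 + Delta * K) = g * eta] turns
     [K * c * M * Delta - g * eta * M] into exactly [- c * M]. *)
  set (c := g * eta / (1 + Delta * K)).
  assert (Hc0 : 0 <= c).
  { apply Rmult_le_pos; [apply Rmult_le_pos; lra|]. left. apply Rinv_0_lt_compat. lra. }
  assert (Hcg : c * (1 + Delta * K) = g * eta) by (unfold c; field; lra).
  set (f := fun t => X j t - (M - c * M * (t - p))).
  assert (Hf : f q <= 0).
  { pose proof Hs as Hs'. destruct Hs as [Hc [L Hd]].
    apply (barrier f L p q Hpq).
    - apply (continuity_minus (X j)); [apply Hc, Hj|].
      intros t. apply derivable_continuous_pt. exists (- (c * M)).
      apply is_derive_Reals. auto_derive; auto. ring.
    - intros t Ht HL.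
      destruct (Hd t ltac:(lra) HL j Hj) as (l & al & be & Hl & Hal & Hbe & Hlead & Hle).
      exists (l - (- (c * M))). split.
      + apply (derivable_pt_lim_minus (X j) (fun t => M - c * M * (t - p))); [exact Hl|].
        apply is_derive_Reals. auto_derive; auto. ring.
      + unfold f. intros Hpos.
        assert (Hmax : forall i, (i < n)%nat -> X i t <= M).
        { apply (subsolution_max n k sigma a_lo a_hi b_lo T X p t M); auto; try lra. }
        pose proof (Hmax j Hj) as Hjm.
        (* Keeps the barrier nonnegative, so that the leader term has the right sign above it. *)
        assert (Htp : c * (t - p) <= 1).
        { apply Rle_trans with (c * Delta); [apply Rmult_le_compat_l; lra|].
          assert (c * Delta * K <= K) by (unfold K in *; nra).
          apply Rmult_le_reg_r with K; lra. }
        assert (HX : 0 <= X j t) by nra.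
        assert (Hterm : forall i, (i < n)%nat -> al i * (X i t - X j t) <= a_hi * (M - X j t)).
        { intros i Hi. specialize (Hal i Hi). specialize (Hmax i Hi).
          destruct (sigma t (FN i) (FN j)).
          - apply Rle_trans with (al i * (M - X j t)).
            + apply Rmult_le_compat_l; lra.
            + apply Rmult_le_compat_r; lra.
          - rewrite Hal. assert (0 <= a_hi * (M - X j t)) by (apply Rmult_le_pos; lra). lra. }
        assert (Hl' : l <= K * (M - X j t) - g * eta * M).
        { assert (HgM : 0 <= g * (M - X j t)) by (apply Rmult_le_pos; lra).
          destruct (Harc t Ht) as [[i [Hi [Hij HiM]]]|[i [Hi Hij]]].
          - assert (Hs2 : sumR n (fun i0 => al i0 * (X i0 t - X j t) - a_hi * (M - X j t))
                    <= - (g * eta * M)).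
            { assert (G1 : al i * (X i t - X j t) - a_hi * (M - X j t) <= - (g * eta * M)).
              { specialize (Hal i Hi). rewrite Hij in Hal.
                assert (0 <= eta * M) by (apply Rmult_le_pos; lra).
                assert (al i * (X i t - X j t) <= al i * ((M - X j t) - eta * M))
                  by (apply Rmult_le_compat_l; lra).
                assert (al i * (M - X j t) <= a_hi * (M - X j t))
                  by (apply Rmult_le_compat_r; lra).
                assert (g * (eta * M) <= al i * (eta * M))
                  by (apply Rmult_le_compat_r; lra).
                lra. }
              pose proof (sumR_ge_term n
                (fun i0 => - (al i0 * (X i0 t - X j t) - a_hi * (M - X j t))) i) as G2.
              cbv beta in G2. rewrite sumR_opp in G2.
              assert (G3 : forall i0, (i0 < n)%nat ->
                0 <= - (al i0 * (X i0 t - X j t) - a_hi * (M - X j t)))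
                by (intros i0 Hi0; specialize (Hterm i0 Hi0); lra).
              specialize (G2 G3 Hi). lra. }
            assert (Hs3 : sumR n (fun i0 => al i0 * (X i0 t - X j t))
              = sumR n (fun i0 => al i0 * (X i0 t - X j t) - a_hi * (M - X j t))
                + INR n * (a_hi * (M - X j t))).
            { rewrite <- sumR_const, <- sumR_plus. apply sumR_ext. intros; ring. }
            assert (0 <= be * X j t) by (apply Rmult_le_pos; lra).
            unfold K. lra.
          - assert (Hs4 : sumR n (fun i0 => al i0 * (X i0 t - X j t))
              <= INR n * (a_hi * (M - X j t))).
            { rewrite <- sumR_const. apply sumR_le. exact Hterm. }
            specialize (Hlead i Hi Hij).
            assert (g * X j t <= be * X j t) by (apply Rmult_le_compat_r; lra).
            assert (g * (eta * M) <= g * M) by (apply Rmult_le_compat_l; nra).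
            unfold K. lra. }
        assert (K * (M - X j t) <= K * (c * M * (t - p))) by (apply Rmult_le_compat_l; lra).
        assert (0 <= c * M) by (apply Rmult_le_pos; lra).
        assert (K * (c * M * (t - p)) <= K * (c * M * Delta))
          by (apply Rmult_le_compat_l; [lra|apply Rmult_le_compat_l; lra]).
        assert (c * (1 + Delta * K) * M = g * eta * M) by (rewrite Hcg; ring).
        lra.
    - unfold f. specialize (H0 j Hj). lra. }
  unfold f in Hf. fold K.
  replace (g * eta * (q - p) / (1 + Delta * K)) with (c * (q - p)) by (unfold c; field; lra).
  lra.
Qed.

(** * Contraction under joint connectivity *)

(** Times at which a step may start: at least [tau] remains of the current dwell interval. *)
Definition grid (s : nat -> R) (tau t : R) : Prop :=
  exists m, s m <= t /\ t + tau <= s (S m).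

(** Dwell intervals are cut into pieces of length between [tau] and [2 * tau], the last piece
    absorbing a remainder shorter than [tau]. The lower bound feeds the gain of a newcomer, the
    upper bound limits the loss of the followers already in the set. *)
Lemma grid_next sigma s tau t :
  0 < tau ->
  (forall m, s m + tau <= s (S m)) ->
  (forall m t, s m <= t < s (S m) -> sigma t = sigma (s m)) ->
  grid s tau t ->
  exists t', grid s tau t' /\ t + tau <= t' <= t + 2 * tau /\
    forall r, t <= r < t' -> sigma r = sigma t :> digraph.
Proof.
  intros Htau Hs Hsig [m [H1 H2]].
  assert (Hconst : forall r, t <= r < s (S m) -> sigma r = sigma t).
  { intros r Hr. rewrite (Hsig m r), (Hsig m t) by lra. reflexivity. }
  destruct (Rlt_dec (s (S m)) (t + 2 * tau)).
  - exists (s (S m)). split; [|split; [lra|exact Hconst]].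
    exists (S m). split; [lra|apply Hs].
  - exists (t + tau). split; [exists m; lra|split; [lra|]].
    intros r Hr. apply Hconst. lra.
Qed.

(** Leaders count as permanently inside, since the shift puts them at level 0 or below. *)
Definition crossing (n k : nat) (G : digraph) (S : list nat) (j : nat) : Prop :=
  (j < n)%nat /\ ~ In j S /\
  ((exists i, (i < n)%nat /\ In i S /\ G (FN i) (FN j) = true) \/
   (exists i, (i < k)%nat /\ G (LN i) (FN j) = true)).

(** A path from a leader to a follower outside [S] contains an arc that passes from the leaders and
    [S] to a follower outside [S]. *)
Lemma JLC_crossing n k sigma S i t :
  (forall t v j, 0 <= t -> valid_node n k v -> (j < k)%nat -> sigma t v (LN j) = false) ->
  JLC n k sigma -> 0 <= t -> (i < n)%nat -> ~ In i S ->
  exists r j, t <= r /\ crossing n k (sigma r) S j.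
Proof.
  intros Hlead HJ Ht Hi HiS.
  destruct (HJ t Ht i Hi) as [j [Hj Hpath]].
  assert (K : forall v w, clos_trans node (joint_arc n k sigma (fun s => t <= s)) v w ->
    (match v with FN i => In i S | LN _ => True end) ->
    (match w with FN i => ~ In i S | LN _ => False end) ->
    exists r j, t <= r /\ crossing n k (sigma r) S j).
  { intros v w H. induction H as [v w [Hv [Hw [r [Hr Harc]]]]|v u w _ IH1 _ IH2]; intros H1 H2.
    - destruct w as [w|w]; [|tauto]. exists r, w. split; [exact Hr|].
      split; [exact Hw|split; [exact H2|]].
      destruct v as [v|v]; [left|right]; exists v; auto.
    - destruct u as [u|u].
      + destruct (classic (In u S)); auto.
      + apply IH2; auto. }
  apply (K _ _ Hpath); auto.
Qed.

(** The bound is asked of all subsolutions at once, so [S], [eta] and the time [t] depend on the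
    switching signal and the weight bounds only, not on a trajectory or a direction. *)
Definition reach n k sigma a_lo a_hi b_lo (p t : R) (S : list nat) (eta : R) : Prop :=
  p <= t /\
  forall T X M, subsolution n k sigma a_lo a_hi b_lo T X -> t <= T -> 0 <= M ->
    (forall i, (i < n)%nat -> X i p <= M) ->
    forall i, (i < n)%nat -> In i S -> X i t <= (1 - eta) * M.

(** The exponential is the fraction of a gap that survives a piece of length at most [2 * tau]; the
    other factor is the gain of a newcomer over at least [tau], with [Delta = 2 * tau] and [g] the
    smaller lower weight bound. *)
Definition gain_rate (n : nat) (a_lo a_hi b_lo tau : R) : R :=
  exp (- (INR n * a_hi) * (2 * tau)) *
  (Rmin a_lo b_lo * tau / (1 + 2 * tau * (INR n * a_hi + Rmin a_lo b_lo))).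

Lemma gain_rate_bounds n a_lo a_hi b_lo tau :
  0 < a_lo -> a_lo <= a_hi -> 0 < b_lo -> 0 < tau ->
  0 < gain_rate n a_lo a_hi b_lo tau < 1 /\
  gain_rate n a_lo a_hi b_lo tau <= exp (- (INR n * a_hi) * (2 * tau)) /\
  exp (- (INR n * a_hi) * (2 * tau)) <= 1.
Proof.
  intros Ha Hah Hb Ht. unfold gain_rate.
  set (g := Rmin a_lo b_lo). assert (Hg : 0 < g) by (apply Rmin_pos; lra).
  assert (HK : 0 <= INR n * a_hi) by (apply Rmult_le_pos; [apply pos_INR|lra]).
  set (K := INR n * a_hi) in *.
  assert (Hgt : 0 < g * tau) by (apply Rmult_lt_0_compat; lra).
  assert (HKt : 0 <= K * tau) by (apply Rmult_le_pos; lra).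
  set (D := 1 + 2 * tau * (K + g)). assert (HD : g * tau < D) by (unfold D; lra).
  assert (H1 : 0 < g * tau / D < 1).
  { split; [apply Rdiv_lt_0_compat; lra|].
    apply Rmult_lt_reg_r with D; [lra|]. unfold Rdiv.
    rewrite Rmult_assoc, Rinv_l; lra. }
  assert (H2 : 0 < exp (- K * (2 * tau)) <= 1).
  { split; [apply exp_pos|]. rewrite <- exp_0.
    destruct (Rle_lt_or_eq_dec (- K * (2 * tau)) 0) as [H|H]; [lra| |].
    - left. now apply exp_increasing.
    - rewrite H. lra. }
  repeat split; nra.
Qed.

(** Without a crossing, bidirectionality also forbids arcs from the complement into [S]. The value
    of [eta] is not degraded, so an arbitrarily long wait for the next crossing costs nothing. *)
Lemma reach_keep n k sigma a_lo a_hi b_lo p t t' S eta :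
  0 < a_lo -> a_lo <= a_hi -> 0 <= p -> t <= t' -> eta <= 1 ->
  (forall i j, (i < n)%nat -> (j < n)%nat ->
     sigma t (FN i) (FN j) = sigma t (FN j) (FN i)) ->
  (forall r, t <= r < t' -> sigma r = sigma t) ->
  (forall j, ~ crossing n k (sigma t) S j) ->
  reach n k sigma a_lo a_hi b_lo p t S eta ->
  reach n k sigma a_lo a_hi b_lo p t' S eta.
Proof.
  intros Ha Hah Hp Htt He Hbi Hsig Hno [H1 H2]. split; [lra|].
  intros T X M Hs HT HM H0 i Hi HiS.
  apply (subsolution_closed n k sigma a_lo a_hi b_lo T X (fun i => In i S) t t'); auto; try lra.
  - apply Rmult_le_pos; lra.
  - intros r i' j Hr Hi' Hj HS HnS. rewrite Hsig by lra.
    destruct (sigma t (FN j) (FN i')) eqn:E; [|reflexivity].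
    exfalso. apply (Hno j). repeat split; auto. left. exists i'.
    rewrite Hbi; auto.
  - intros i' Hi' HS. apply (H2 T X M); auto. lra.
Qed.

(** Old members keep at least the fraction [lam] of their gap throughout the piece, so at every
    moment the newcomer hears a leader or a follower [lam * eta * M] below [M]. *)
Lemma reach_grow n k sigma a_lo a_hi b_lo tau p t t' S eta j :
  0 < a_lo -> a_lo <= a_hi -> 0 < b_lo -> 0 < tau -> 0 <= p ->
  t + tau <= t' <= t + 2 * tau -> 0 <= eta <= 1 ->
  (forall r, t <= r < t' -> sigma r = sigma t) ->
  crossing n k (sigma t) S j ->
  reach n k sigma a_lo a_hi b_lo p t S eta ->
  reach n k sigma a_lo a_hi b_lo p t' (j :: S) (gain_rate n a_lo a_hi b_lo tau * eta).
Proof.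
  intros Ha Hah Hb Htau Hp Htt He Hsig (Hj & HjS & Harc) [H1 H2]. split; [lra|].
  intros T X M Hs HT HM H0 i Hi HiS.
  destruct (gain_rate_bounds n a_lo a_hi b_lo tau) as (Hr & Hr1 & Hl1); auto.
  assert (Hmax : forall r, t <= r <= t' -> forall i, (i < n)%nat -> X i r <= M).
  { intros r Hrr. apply (subsolution_max n k sigma a_lo a_hi b_lo T X p r M); auto; lra. }
  assert (HK : 0 <= INR n * a_hi) by (apply Rmult_le_pos; [apply pos_INR|lra]).
  set (lam := exp (- (INR n * a_hi) * (2 * tau))) in *.
  assert (Hlam : 0 < lam) by apply exp_pos.
  assert (Hdec : forall r, t <= r <= t' -> forall i, (i < n)%nat -> In i S ->
    X i r <= (1 - lam * eta) * M).
  { intros r Hrr i' Hi' HS.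
    assert (X i' r <= (1 - eta * exp (- (INR n * a_hi) * (r - t))) * M).
    { apply (subsolution_decay n k sigma a_lo a_hi b_lo T X t r M eta i'); auto; try lra.
      - apply Hmax; lra.
      - apply (H2 T X M); auto. lra. }
    assert (lam <= exp (- (INR n * a_hi) * (r - t))).
    { unfold lam. assert (Hle : - (INR n * a_hi) * (2 * tau) <= - (INR n * a_hi) * (r - t)) by nra.
      destruct Hle as [Hlt|Heq]; [left; now apply exp_increasing|rewrite Heq; lra]. }
    assert (lam * (eta * M) <= exp (- (INR n * a_hi) * (r - t)) * (eta * M)).
    { apply Rmult_le_compat_r; [apply Rmult_le_pos; lra|assumption]. }
    lra. }
  assert (Hle1 : 0 <= lam * eta <= 1) by nra.
  destruct HiS as [<-|HiS].
  - set (g := Rmin a_lo b_lo). assert (Hg : 0 < g) by (apply Rmin_pos; lra).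
    assert (Hgain : X j t' <= (1 - g * (lam * eta) * (t' - t)
                     / (1 + 2 * tau * (INR n * a_hi + g))) * M).
    { apply (subsolution_gain n k sigma a_lo a_hi b_lo T X t t' M (lam * eta) g (2 * tau) j);
        auto; try lra.
      - apply Rmin_l.
      - apply Rmin_r.
      - apply Hmax; lra.
      - intros r Hrr. rewrite Hsig by lra.
        destruct Harc as [(i' & Hi' & HS & Hij)|(i' & Hi' & Hij)]; [left|right]; exists i'; auto.
        repeat split; auto. apply Hdec; auto; lra. }
    assert (Hrate : gain_rate n a_lo a_hi b_lo tau * eta
       <= g * (lam * eta) * (t' - t) / (1 + 2 * tau * (INR n * a_hi + g))).
    { unfold gain_rate. fold lam g. set (D := 1 + 2 * tau * (INR n * a_hi + g)).
      assert (HD : 0 < / D).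
      { apply Rinv_0_lt_compat. unfold D.
        assert (0 <= tau * (INR n * a_hi + g)) by (apply Rmult_le_pos; lra). lra. }
      unfold Rdiv.
      replace (lam * (g * tau * / D) * eta) with (g * (lam * eta) * / D * tau) by ring.
      replace (g * (lam * eta) * (t' - t) * / D) with (g * (lam * eta) * / D * (t' - t)) by ring.
      apply Rmult_le_compat_l; [|lra].
      apply Rmult_le_pos; [apply Rmult_le_pos; lra|lra]. }
    nra.
  - specialize (Hdec t' ltac:(lra) i Hi HiS).
    assert (gain_rate n a_lo a_hi b_lo tau * eta <= lam * eta) by nra. nra.
Qed.

(** Each step lasts at least [tau], so [N] bounds the number of steps up to the known crossing time
    [r]. The earliest crossing met on the way is used, possibly by another follower; at the latest,
    it is the one on the piece containing [r]. *)
Lemma reach_next n k sigma a_lo a_hi b_lo s tau p S eta :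
  0 < a_lo -> a_lo <= a_hi -> 0 < b_lo -> 0 < tau -> 0 <= p ->
  (forall m, s m + tau <= s (Datatypes.S m)) ->
  (forall m t, s m <= t < s (Datatypes.S m) -> sigma t = sigma (s m)) ->
  (forall t, 0 <= t -> forall i j, (i < n)%nat -> (j < n)%nat ->
     sigma t (FN i) (FN j) = sigma t (FN j) (FN i)) ->
  0 <= eta <= 1 ->
  forall N t r j, grid s tau t -> reach n k sigma a_lo a_hi b_lo p t S eta ->
  t <= r < t + INR N * tau -> crossing n k (sigma r) S j ->
  exists t' j', grid s tau t' /\ ~ In j' S /\ (j' < n)%nat /\
    reach n k sigma a_lo a_hi b_lo p t' (j' :: S) (gain_rate n a_lo a_hi b_lo tau * eta).
Proof.
  intros Ha Hah Hb Htau Hp Hs Hsig Hbi He.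
  induction N as [|N IH]; intros t r j Hg HR Hr Hcr; [simpl in Hr; lra|].
  rewrite S_INR in Hr.
  destruct (grid_next sigma s tau t Htau Hs Hsig Hg) as (t' & Hg' & Ht' & Hconst).
  assert (Hpt : p <= t) by apply HR.
  destruct (classic (exists j', crossing n k (sigma t) S j')) as [[j' Hj']|Hno].
  - exists t', j'. repeat split; auto; try apply Hj'.
    + destruct HR; lra.
    + apply (reach_grow n k sigma a_lo a_hi b_lo tau p t t' S eta j'); auto.
  - destruct (Rlt_dec r t') as [Hrt|Hrt].
    + exfalso. apply Hno. exists j. rewrite <- (Hconst r); auto. lra.
    + apply (IH t' r j); auto; [|lra].
      apply (reach_keep n k sigma a_lo a_hi b_lo p t t' S eta); auto; try lra.
      * apply Hbi. lra.
      * intros j' Hj'. apply Hno. exists j'. exact Hj'.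
Qed.

Lemma window_contraction n k sigma a_lo a_hi b_lo s tau :
  0 < a_lo -> a_lo <= a_hi -> 0 < b_lo -> 0 < tau ->
  (forall m, s m + tau <= s (S m)) ->
  (forall m t, s m <= t < s (S m) -> sigma t = sigma (s m)) ->
  (forall t v j, 0 <= t -> valid_node n k v -> (j < k)%nat -> sigma t v (LN j) = false) ->
  (forall t, 0 <= t -> forall i j, (i < n)%nat -> (j < n)%nat ->
     sigma t (FN i) (FN j) = sigma t (FN j) (FN i)) ->
  JLC n k sigma ->
  exists eta, 0 < eta <= 1 /\ forall p, 0 <= p -> grid s tau p ->
    exists t, grid s tau t /\ p <= t /\
    forall T X M, subsolution n k sigma a_lo a_hi b_lo T X -> t <= T -> 0 <= M ->
      (forall i, (i < n)%nat -> X i p <= M) ->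
      forall i, (i < n)%nat -> X i t <= (1 - eta) * M.
Proof.
  intros Ha Hah Hb Htau Hs Hsig Hlead Hbi HJ.
  destruct (gain_rate_bounds n a_lo a_hi b_lo tau) as (Hth & _); auto.
  set (th := gain_rate n a_lo a_hi b_lo tau) in *.
  assert (Hpow : forall m, 0 < th ^ m <= 1).
  { induction m as [|m IH]; simpl; [lra|]. nra. }
  (* One factor per follower that joins: the contraction does not depend on [p], although the length
     of the window may. *)
  exists (th ^ n). split; [apply Hpow|]. intros p Hp Hgp.
  assert (K : forall c, (c <= n)%nat -> exists t S, grid s tau t /\ NoDup S /\
    (forall i, In i S -> (i < n)%nat) /\ length S = c /\
    reach n k sigma a_lo a_hi b_lo p t S (th ^ c)).
  { induction c as [|c IH]; intros Hc.
    (* Growth starts from the empty set with [eta = 1], for which the bound is vacuous. *)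
    - exists p, nil. repeat split; auto; try (constructor); try lra; intros; simpl in *; tauto.
    - destruct IH as (t & S & Hg & Hnd & Hin & Hlen & HR); [lia|].
      assert (Hex : exists i, (i < n)%nat /\ ~ In i S).
      { apply NNPP. intros Hno.
        assert (Hincl : incl (seq 0 n) S).
        { intros i Hi. apply in_seq in Hi. apply NNPP. intros H. apply Hno. exists i. split; [lia|exact H]. }
        pose proof (NoDup_incl_length (seq_NoDup n 0) Hincl) as H. rewrite length_seq in H. lia. }
      destruct Hex as [i [Hi HiS]].
      assert (Hpt : p <= t) by apply HR.
      destruct (JLC_crossing n k sigma S i t) as (r & j & Hr & Hcr); auto; [lra|].
      destruct (INR_unbounded ((r - t) / tau)) as [N HN].
      assert (HrN : r < t + INR N * tau).
      { apply Rmult_lt_compat_r with (r := tau) in HN; [|exact Htau].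
        unfold Rdiv in HN. rewrite Rmult_assoc, Rinv_l in HN; lra. }
      destruct (reach_next n k sigma a_lo a_hi b_lo s tau p S (th ^ c))
        with (N := N) (t := t) (r := r) (j := j)
        as (t' & j' & Hg' & Hj' & Hjn & HR'); auto.
      { pose proof (Hpow c). lra. }
      exists t', (j' :: S). repeat split; auto.
      + constructor; auto.
      + intros i' [<-|H]; auto.
      + simpl. lia.
      + apply HR'.
      + apply HR'. }
  destruct (K n (le_n n)) as (t & S & Hg & Hnd & Hin & Hlen & HR).
  exists t. split; [exact Hg|]. split; [apply HR|].
  intros T X M Hsub HT HM H0 i Hi. destruct HR as [_ HR].
  apply (HR T X M); auto.
  apply (NoDup_length_incl (l := S) (l' := seq 0 n)); auto.
  - rewrite length_seq. lia.
  - intros i' Hi'. apply in_seq. specialize (Hin i' Hi'). lia.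
  - apply in_seq. lia.
Qed.

(** Quantifying over all horizons [T] beyond [t] makes the predicate monotone in [t] as well as in
    [c], which the passage to the infimum uses. *)
Definition decay_bound n k sigma a_lo a_hi b_lo (t c : R) : Prop :=
  0 <= c /\ forall T X M, subsolution n k sigma a_lo a_hi b_lo T X -> t <= T -> 0 <= M ->
    (forall i, (i < n)%nat -> X i 0 <= M) ->
    forall i, (i < n)%nat -> X i T <= c * M.

Lemma decay_bound_small n k sigma a_lo a_hi b_lo s tau :
  0 < a_lo -> a_lo <= a_hi -> 0 < b_lo -> 0 < tau -> s O = 0 ->
  (forall m, s m + tau <= s (S m)) ->
  (forall m t, s m <= t < s (S m) -> sigma t = sigma (s m)) ->
  (forall t v j, 0 <= t -> valid_node n k v -> (j < k)%nat -> sigma t v (LN j) = false) ->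
  (forall t, 0 <= t -> forall i j, (i < n)%nat -> (j < n)%nat ->
     sigma t (FN i) (FN j) = sigma t (FN j) (FN i)) ->
  JLC n k sigma ->
  forall eps, 0 < eps -> exists t c, 0 <= t /\ c < eps /\ decay_bound n k sigma a_lo a_hi b_lo t c.
Proof.
  intros Ha Hah Hb Htau Hs0 Hs Hsig Hlead Hbi HJ eps Heps.
  destruct (window_contraction n k sigma a_lo a_hi b_lo s tau) as (eta & Heta & Hw); auto.
  assert (Hpow : forall q, 0 <= (1 - eta) ^ q).
  { intros q. apply pow_le. lra. }
  assert (K : forall q, exists t, grid s tau t /\ 0 <= t /\
    forall T X M, subsolution n k sigma a_lo a_hi b_lo T X -> t <= T -> 0 <= M ->
      (forall i, (i < n)%nat -> X i 0 <= M) ->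
      forall i, (i < n)%nat -> X i t <= (1 - eta) ^ q * M).
  { induction q as [|q IH].
    - exists 0. split; [exists O; specialize (Hs O); lra|]. split; [lra|].
      intros T X M _ _ _ H0 i Hi. simpl. rewrite Rmult_1_l. auto.
    - destruct IH as (t & Hg & Ht & H).
      destruct (Hw t Ht Hg) as (t' & Hg' & Ht' & H').
      exists t'. split; [exact Hg'|split; [lra|]].
      intros T X M Hsub HT HM H0 i Hi. simpl. rewrite Rmult_assoc.
      apply (H' T X); auto.
      + apply Rmult_le_pos; auto.
      + apply (H T X); auto. lra. }
  destruct (pow_lt_1_zero (1 - eta)) with (y := eps) as [q Hq];
    [rewrite Rabs_pos_eq; lra|exact Heps|].
  destruct (K q) as (t & _ & Ht & H).
  exists t, ((1 - eta) ^ q). split; [exact Ht|]. split.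
  - specialize (Hq q (le_n q)). rewrite Rabs_pos_eq in Hq; auto.
  - split; [apply Hpow|]. intros T X M Hsub HT HM H0.
    apply (subsolution_max n k sigma a_lo a_hi b_lo T X t T); auto; try lra.
    + apply Rmult_le_pos; auto.
    + apply (H T X M); auto.
Qed.

(** * A positive nonincreasing rate from admissible constants *)

Lemma glb_exists (Q : R -> Prop) :
  (exists c, Q c) -> (forall c, Q c -> 0 <= c) ->
  exists g, (forall c, Q c -> g <= c) /\ (forall g', (forall c, Q c -> g' <= c) -> g' <= g).
Proof.
  intros [c0 Hc0] Hpos.
  destruct (completeness (fun x => Q (- x))) as [m [Hub Hlub]].
  - exists 0. intros x Hx. specialize (Hpos _ Hx). lra.
  - exists (- c0). rewrite Ropp_involutive. exact Hc0.
  - exists (- m). split.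
    + intros c Hc. specialize (Hub (- c)). cbv beta in Hub. rewrite Ropp_involutive in Hub.
      specialize (Hub Hc). lra.
    + intros g' Hg'. specialize (Hlub (- g')).
      assert (m <= - g'); [|lra]. apply Hlub. intros x Hx. specialize (Hg' _ Hx). lra.
Qed.

(* [exp (- t)] keeps the infimum positive and strictly above some admissible constant. *)
Lemma decay_profile (Q : R -> R -> Prop) :
  (forall t, 0 <= t -> exists c, Q t c) ->
  (forall t c, Q t c -> 0 <= c) ->
  (forall t t' c, t <= t' -> Q t c -> Q t' c) ->
  (forall t c c', c <= c' -> Q t c -> Q t c') ->
  (forall eps, 0 < eps -> exists t c, 0 <= t /\ c < eps /\ Q t c) ->
  exists phi : R -> R, (forall t, 0 <= t -> 0 < phi t /\ Q t (phi t)) /\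
    (forall t t', 0 <= t -> t <= t' -> phi t' <= phi t) /\
    (forall eps, 0 < eps -> exists T, 0 <= T /\ forall t, T <= t -> phi t < eps).
Proof.
  intros Hex Hpos Ht Hc Hsmall.
  set (isglb := fun t g => (forall c, Q t c -> g <= c) /\
                 (forall g', (forall c, Q t c -> g' <= c) -> g' <= g)).
  set (G := fun t => epsilon (inhabits 0) (isglb t)).
  assert (HG : forall t, 0 <= t -> isglb t (G t)).
  { intros t H. apply epsilon_spec. apply glb_exists; [now apply Hex|apply Hpos]. }
  exists (fun t => G t + exp (- t)). split; [|split].
  - intros t H. destruct (HG t H) as [H1 H2]. pose proof (exp_pos (- t)) as He.
    assert (0 <= G t) by (apply H2; intros; eapply Hpos; eauto).
    split; [lra|]. apply NNPP. intros Hn.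
    assert (Hg : G t + exp (- t) <= G t); [|lra]. apply H2. intros c Hq.
    apply Rnot_lt_le. intros Hlt. apply Hn. apply (Hc t c); [lra|exact Hq].
  - intros t t' H Htt. apply Rplus_le_compat.
    + destruct (HG t H) as [_ H2]. apply H2. intros c Hq.
      apply (HG t'); [lra|]. apply (Ht t); auto.
    + destruct Htt as [Hlt| ->]; [left; apply exp_increasing; lra|lra].
  - intros eps Heps. destruct (Hsmall (eps / 2)) as (t & c & H0 & Hlt & Hq); [lra|].
    exists (Rmax t (- ln (eps / 2) + 1)). split.
    { eapply Rle_trans; [exact H0|apply Rmax_l]. }
    intros t' Ht'.
    assert (t <= t') by (eapply Rle_trans; [apply Rmax_l|exact Ht']).
    assert (- ln (eps / 2) + 1 <= t') by (eapply Rle_trans; [apply Rmax_r|exact Ht']).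
    assert (G t' <= c) by (apply (HG t'); [lra|apply (Ht t); auto]).
    assert (exp (- t') < eps / 2).
    { rewrite <- (exp_ln (eps / 2)) by lra. apply exp_increasing. lra. }
    lra.
Qed.

(** * Distance to the convex hull *)

Definition dot (d : nat) (v x : nat -> R) : R := sumR d (fun l => v l * x l).

Lemma vnorm_nonneg d v : 0 <= vnorm d v.
Proof. apply sqrt_pos. Qed.

Lemma vnorm_sqr d v : vnorm d v ^ 2 = sumR d (fun l => v l ^ 2).
Proof.
  unfold vnorm. rewrite pow2_sqrt; [reflexivity|].
  apply sumR_nonneg. intros; apply pow2_ge_0.
Qed.

Lemma dot_minus d v x y : dot d v (fun l => x l - y l) = dot d v x - dot d v y.
Proof.
  unfold dot.
  rewrite (sumR_ext d (fun l => v l * (x l - y l)) (fun l => v l * x l + - (v l * y l)))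
    by (intros; ring).
  rewrite sumR_plus, sumR_opp. ring.
Qed.

Lemma dot_le_vnorm d v x :
  sumR d (fun l => v l ^ 2) <= 1 -> dot d v x <= vnorm d x.
Proof.
  (* Working with [r + eps] avoids division by a zero norm. *)
  intros Hv. apply le_epsilon. intros eps He.
  pose proof (vnorm_nonneg d x) as Hr. pose proof (vnorm_sqr d x) as Hx.
  set (r := vnorm d x) in *.
  assert (H : 2 * (r + eps) * dot d v x
     <= (r + eps) ^ 2 * sumR d (fun l => v l ^ 2) + sumR d (fun l => x l ^ 2)).
  { unfold dot. rewrite <- !sumR_scal, <- sumR_plus. apply sumR_le. intros l _.
    pose proof (pow2_ge_0 ((r + eps) * v l - x l)). nra. }
  rewrite <- Hx in H.
  assert ((r + eps) ^ 2 * sumR d (fun l => v l ^ 2) <= (r + eps) ^ 2 * 1)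
    by (apply Rmult_le_compat_l; [apply pow2_ge_0|exact Hv]).
  apply Rmult_le_reg_l with (2 * (r + eps)); nra.
Qed.

Lemma in_hull_vertex k d ys j : (j < k)%nat -> in_hull k d ys (ys j).
Proof.
  intros Hj. exists (fun i => if Nat.eq_dec i j then 1 else 0). split; [|split].
  - intros i _. destruct (Nat.eq_dec i j); lra.
  - rewrite (sumR_single k _ j Hj).
    + destruct (Nat.eq_dec j j); [reflexivity|lia].
    + intros i _ Hne. destruct (Nat.eq_dec i j); [lia|reflexivity].
  - intros l _. rewrite (sumR_single k _ j Hj).
    + destruct (Nat.eq_dec j j); [ring|lia].
    + intros i _ Hne. destruct (Nat.eq_dec i j); [lia|ring].
Qed.

Lemma in_hull_segment k d ys p q s :
  0 <= s <= 1 -> in_hull k d ys p -> in_hull k d ys q ->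
  in_hull k d ys (fun l => p l + s * (q l - p l)).
Proof.
  intros Hs (a & Ha & Ha1 & Hap) (b & Hb & Hb1 & Hbq).
  exists (fun j => (1 - s) * a j + s * b j). split; [|split].
  - intros j Hj. specialize (Ha j Hj). specialize (Hb j Hj). nra.
  - rewrite sumR_plus, !sumR_scal, Ha1, Hb1. ring.
  - intros l Hl. rewrite (Hap l Hl), (Hbq l Hl).
    rewrite (sumR_ext k (fun j => ((1 - s) * a j + s * b j) * ys j l)
      (fun j => (1 - s) * (a j * ys j l) + s * (b j * ys j l))) by (intros; ring).
    rewrite sumR_plus, !sumR_scal. ring.
Qed.

Lemma in_hull_bounded k d ys p l :
  in_hull k d ys p -> (l < d)%nat -> Rabs (p l) <= sumR k (fun j => Rabs (ys j l)).
Proof.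
  intros (a & Ha & Ha1 & Hp) Hl. rewrite (Hp l Hl).
  eapply Rle_trans; [apply sumR_abs|]. apply sumR_le. intros j Hj.
  rewrite Rabs_mult, (Rabs_pos_eq (a j)) by auto.
  assert (a j <= 1) by (rewrite <- Ha1; now apply sumR_ge_term).
  pose proof (Rabs_pos (ys j l)). specialize (Ha j Hj). nra.
Qed.

(** The infimum that [epsilon] is to select exists: norms are nonnegative, and for [k >= 1] the hull
    contains the leader of index 0. *)
Lemma hull_dist_spec k d ys v : (1 <= k)%nat ->
  (forall p, in_hull k d ys p -> hull_dist k d ys v <= vnorm d (fun l => v l - p l)) /\
  (forall r', (forall p, in_hull k d ys p -> r' <= vnorm d (fun l => v l - p l)) ->
     r' <= hull_dist k d ys v).
Proof.
  intros Hk.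
  apply (epsilon_spec (inhabits 0) (fun r =>
    (forall p, in_hull k d ys p -> r <= vnorm d (fun l => v l - p l)) /\
    (forall r', (forall p, in_hull k d ys p -> r' <= vnorm d (fun l => v l - p l)) -> r' <= r))).
  destruct (glb_exists (fun c => exists p, in_hull k d ys p /\ c = vnorm d (fun l => v l - p l)))
    as [g [H1 H2]].
  - eexists. exists (ys O). split; [apply in_hull_vertex; lia|reflexivity].
  - intros c (p & _ & ->). apply vnorm_nonneg.
  - exists g. split.
    + intros p Hp. apply H1. exists p. auto.
    + intros r' Hr'. apply H2. intros c (p & Hp & ->). auto.
Qed.

(** The easy half of duality: a bound on a linear form at the leaders passes to convex combinations,
    and Cauchy-Schwarz compares with the norm. *)
Lemma hull_dist_support k d ys x v c : (1 <= k)%nat ->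
  sumR d (fun l => v l ^ 2) <= 1 ->
  (forall j, (j < k)%nat -> dot d v (ys j) <= c) ->
  dot d v x - c <= hull_dist k d ys x.
Proof.
  intros Hk Hv Hc. apply (hull_dist_spec k d ys x Hk). intros p (a & Ha & Ha1 & Hp).
  assert (dot d v p <= c).
  { replace (dot d v p) with (sumR k (fun j => a j * dot d v (ys j))).
    - rewrite <- (Rmult_1_r c), <- Ha1, <- sumR_scal. apply sumR_le. intros j Hj.
      specialize (Ha j Hj). specialize (Hc j Hj). nra.
    - unfold dot.
      rewrite (sumR_ext k _ (fun j => sumR d (fun l => a j * (v l * ys j l))))
        by (intros; now rewrite sumR_scal).
      rewrite sumR_swap. apply sumR_ext. intros l Hl. rewrite (Hp l Hl), <- sumR_scal.
      apply sumR_ext. intros; ring. }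
  pose proof (dot_le_vnorm d v (fun l => x l - p l) Hv) as Hn. rewrite dot_minus in Hn. lra.
Qed.

(* First-order optimality at an almost closest point of the hull, so that no
   compactness of the hull is needed. *)
Lemma hull_dist_separate k d ys x delta : (1 <= k)%nat -> 0 < delta ->
  exists v, sumR d (fun l => v l ^ 2) <= 1 /\
    forall j, (j < k)%nat -> hull_dist k d ys x - delta <= dot d v x - dot d v (ys j).
Proof.
  intros Hk Hdelta. destruct (hull_dist_spec k d ys x Hk) as [Hlow Hglb].
  set (r := hull_dist k d ys x) in *.
  (* At distance 0 a separating direction may not exist; the zero vector satisfies the claim. *)
  destruct (Rle_dec r 0) as [Hr|Hr].
  { exists (fun _ => 0). split.
    - rewrite sumR_zero; [lra|intros; ring].
    - intros j _. unfold dot. rewrite !sumR_zero by (intros; ring). lra. }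
  apply Rnot_le_lt in Hr.
  set (mm := fun l => sumR k (fun j => Rabs (ys j l))).
  set (B := sumR d (fun l => (2 * mm l) ^ 2)).
  assert (HB : 0 <= B) by (apply sumR_nonneg; intros; apply pow2_ge_0).
  assert (Hdr : 0 < delta * r) by (apply Rmult_lt_0_compat; lra).
  (* [s] is the relative length of a test move from the near-minimiser [p] towards a leader, and
     [eps] is the slack of [p]. Expanding the square gives [2 * s * D <= eps + s^2 * E], where both
     terms on the right are at most [delta * r * s] because [E <= B] and [s * B <= delta * r]. *)
  set (s := Rmin 1 (delta * r / (B + 1))).
  assert (Hs0 : 0 < s) by (apply Rmin_pos; [lra|apply Rdiv_lt_0_compat; lra]).
  assert (Hs1 : s <= 1) by apply Rmin_l.
  assert (HsB : s * B <= delta * r).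
  { assert (s <= delta * r / (B + 1)) by apply Rmin_r.
    apply Rle_trans with (delta * r / (B + 1) * B).
    - apply Rmult_le_compat_r; lra.
    - apply Rmult_le_reg_r with (B + 1); [lra|].
      replace (delta * r / (B + 1) * B * (B + 1)) with (delta * r * B) by (field; lra). nra. }
  set (eps := delta * r * s). assert (Heps : 0 < eps) by (apply Rmult_lt_0_compat; lra).
  assert (Hp : exists p, in_hull k d ys p /\ vnorm d (fun l => x l - p l) ^ 2 <= r ^ 2 + eps).
  { apply NNPP. intros Hno.
    assert (sqrt (r ^ 2 + eps) <= r).
    { apply Hglb. intros p Hp. apply Rnot_lt_le. intros Hlt. apply Hno. exists p. split; [exact Hp|].
      pose proof (vnorm_nonneg d (fun l => x l - p l)).
      rewrite <- (pow2_sqrt (r ^ 2 + eps)) by nra. apply pow_incr. lra. }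
    assert (r < sqrt (r ^ 2 + eps)).
    { rewrite <- (sqrt_pow2 r) at 1 by lra. apply sqrt_lt_1; nra. }
    lra. }
  destruct Hp as (p & Hp & Hpr).
  set (rho := vnorm d (fun l => x l - p l)) in *.
  assert (Hrho : r <= rho) by (apply Hlow, Hp).
  exists (fun l => (x l - p l) / rho). split.
  - rewrite (sumR_ext d _ (fun l => / rho ^ 2 * (x l - p l) ^ 2)) by (intros; field; lra).
    rewrite sumR_scal, <- (vnorm_sqr d (fun l => x l - p l)). fold rho.
    rewrite Rinv_l; [lra|]. apply pow_nonzero. lra.
  - intros j Hj.
    set (D := sumR d (fun l => (x l - p l) * (ys j l - p l))).
    set (E := sumR d (fun l => (ys j l - p l) ^ 2)).
    assert (HE : E <= B).
    { apply sumR_le. intros l Hl.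
      pose proof (in_hull_bounded k d ys p l Hp Hl) as H1. fold (mm l) in H1.
      pose proof (in_hull_bounded k d ys (ys j) l (in_hull_vertex k d ys j Hj) Hl) as H2.
      fold (mm l) in H2. apply Rabs_le_between in H1. apply Rabs_le_between in H2.
      assert (0 <= mm l) by (apply sumR_nonneg; intros; apply Rabs_pos). nra. }
    assert (HD : D <= delta * r).
    { assert (Hq : r <= vnorm d (fun l => x l - (p l + s * (ys j l - p l)))).
      { apply Hlow. apply in_hull_segment; [lra|exact Hp|now apply in_hull_vertex]. }
      assert (Hq2 : r ^ 2 <= rho ^ 2 - 2 * s * D + s ^ 2 * E).
      { apply Rle_trans with (vnorm d (fun l => x l - (p l + s * (ys j l - p l))) ^ 2).
        - apply pow_incr. lra.
        - unfold rho. rewrite !vnorm_sqr. unfold D, E.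
          rewrite (sumR_ext d (fun l => (x l - (p l + s * (ys j l - p l))) ^ 2)
            (fun l => (x l - p l) ^ 2 + (- (2 * s) * ((x l - p l) * (ys j l - p l))
                      + s ^ 2 * (ys j l - p l) ^ 2))) by (intros; ring).
          rewrite !sumR_plus, !sumR_scal. lra. }
      assert (s ^ 2 * E <= s * (delta * r)).
      { replace (s ^ 2 * E) with (s * (s * E)) by ring. apply Rmult_le_compat_l; [lra|].
        apply Rle_trans with (s * B); [apply Rmult_le_compat_l; lra|exact HsB]. }
      assert (H2 : 2 * s * D <= 2 * s * (delta * r)) by (unfold eps in *; nra).
      apply Rmult_le_reg_l in H2; lra. }
    rewrite <- dot_minus. unfold dot.
    rewrite (sumR_ext d _ (fun l => / rho * ((x l - p l) ^ 2) + - (/ rho * ((x l - p l) * (ys j l - p l)))))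
      by (intros; field; lra).
    rewrite sumR_plus, sumR_opp, !sumR_scal, <- (vnorm_sqr d (fun l => x l - p l)).
    fold rho. fold D.
    replace (/ rho * rho ^ 2) with rho by (field; lra).
    assert (/ rho * D <= delta); [|lra].
    apply Rmult_le_reg_l with rho; [lra|].
    replace (rho * (/ rho * D)) with D by (field; lra). nra.
Qed.

(** * Finite maxima, extension to negative times, finite uniform choices *)

Lemma maxR_nonneg m f : 0 <= maxR m f.
Proof. induction m; simpl; [lra|]. eapply Rle_trans; [exact IHm|apply Rmax_l]. Qed.

Lemma maxR_ge m f i : (i < m)%nat -> f i <= maxR m f.
Proof.
  induction m as [|m IH]; intros Hi; [lia|]. simpl.
  destruct (Nat.eq_dec i m) as [->|]; [apply Rmax_r|].
  eapply Rle_trans; [apply IH; lia|apply Rmax_l].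
Qed.

Lemma maxR_le m f c : 0 <= c -> (forall i, (i < m)%nat -> f i <= c) -> maxR m f <= c.
Proof.
  intros Hc. induction m as [|m IH]; intros H; simpl; [exact Hc|].
  apply Rmax_lub; [apply IH; intros|]; apply H; lia.
Qed.

Lemma argmax_exists k (q : nat -> R) : (1 <= k)%nat ->
  exists j, (j < k)%nat /\ forall i, (i < k)%nat -> q i <= q j.
Proof.
  induction k as [|[|k] IH]; intros Hk; [lia| |].
  - exists O. split; [lia|]. intros i Hi. replace i with O by lia. lra.
  - destruct IH as (j & Hj & H); [lia|].
    destruct (Rle_dec (q (S k)) (q j)).
    + exists j. split; [lia|]. intros i Hi. destruct (Nat.eq_dec i (S k)) as [->|]; [lra|apply H; lia].
    + exists (S k). split; [lia|]. intros i Hi. destruct (Nat.eq_dec i (S k)) as [->|]; [lra|].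
      specialize (H i ltac:(lia)). lra.
Qed.

(** Trajectories are only controlled at nonnegative times; freezing them before 0 gives the
    two-sided continuity that the comparison lemmas ask for. *)
Lemma cont_nonneg_extend f : cont_nonneg f -> continuity (fun t => f (Rmax 0 t)).
Proof.
  intros H t. apply continuity_pt_eps. intros eps He.
  destruct (H (Rmax 0 t) eps (Rmax_l _ _) He) as (d & Hd & Hs).
  exists d. split; [exact Hd|]. intros s Hst. apply Hs; [apply Rmax_l|].
  apply Rabs_def2 in Hst. apply Rabs_def1; unfold Rmax;
    destruct (Rle_dec 0 s), (Rle_dec 0 t); lra.
Qed.

Lemma derivable_pt_lim_extend f t l : 0 < t ->
  derivable_pt_lim f t l -> derivable_pt_lim (fun s => f (Rmax 0 s)) t l.
Proof.
  intros Ht. apply derivable_pt_lim_local with t; [exact Ht|].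
  intros s Hs. apply Rabs_def2 in Hs. rewrite Rmax_right by lra. reflexivity.
Qed.

Lemma finite_delta m (Q : nat -> R -> Prop) :
  (forall i d d', d' <= d -> Q i d -> Q i d') ->
  (forall i, (i < m)%nat -> exists d, 0 < d /\ Q i d) ->
  exists d, 0 < d /\ forall i, (i < m)%nat -> Q i d.
Proof.
  intros Hmono. induction m as [|m IH]; intros H.
  - exists 1. split; [lra|]. intros; lia.
  - destruct IH as (d & Hd & HQ); [intros; apply H; lia|].
    destruct (H m) as (d' & Hd' & HQ'); [lia|].
    exists (Rmin d d'). split; [now apply Rmin_pos|]. intros i Hi.
    destruct (Nat.eq_dec i m) as [->|].
    + apply Hmono with d'; [apply Rmin_r|exact HQ'].
    + apply Hmono with d; [apply Rmin_l|]. apply HQ. lia.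
Qed.

Lemma finite_list m (Q : nat -> list R -> Prop) :
  (forall i L L', incl L L' -> Q i L -> Q i L') ->
  (forall i, (i < m)%nat -> exists L, Q i L) ->
  exists L, forall i, (i < m)%nat -> Q i L.
Proof.
  intros Hmono. induction m as [|m IH]; intros H.
  - exists nil. intros; lia.
  - destruct IH as (L & HQ); [intros; apply H; lia|].
    destruct (H m) as (L' & HQ'); [lia|].
    exists (L ++ L'). intros i Hi. destruct (Nat.eq_dec i m) as [->|].
    + apply Hmono with L'; [apply incl_appr, incl_refl|exact HQ'].
    + apply Hmono with L; [apply incl_appl, incl_refl|]. apply HQ. lia.
Qed.

(** * Regularity of the inputs and primitive of their norm *)

Lemma partition_locate (r : nat -> R) t : forall M, r O <= t -> t < r M ->
  exists m, (m < M)%nat /\ r m <= t < r (S m).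
Proof.
  induction M as [|M IH]; intros H0 HM; [lra|].
  destruct (Rlt_dec t (r M)) as [H|H].
  - destruct (IH H0 H) as (m & Hm & Hr). exists m. split; [lia|exact Hr].
  - exists M. split; [lia|lra].
Qed.

(** Inside a piece of the partition [ui] agrees with a jointly continuous function, which composes
    with [y]; only the finitely many partition points up to [T] are lost. *)
Lemma admissible_u_continuity k d ui (y : R -> Vecs) T :
  admissible_u k d ui ->
  (forall j l, (j < k)%nat -> (l < d)%nat -> cont_nonneg (fun s => y s j l)) ->
  exists L : list R, forall t, 0 < t < T -> ~ In t L -> forall l, (l < d)%nat ->
    continuity_pt (fun s => ui (y s) s l) t.
Proof.
  intros [_ (r & Hr0 & Hr & Hru & Hg)] Hy.
  destruct (Hru T) as [M HM].
  exists (map r (seq 0 (S M))). intros t Ht HL l Hl.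
  destruct (partition_locate r t M) as (m & Hm & Hrm); [lra|lra|].
  assert (Hrne : r m <> t).
  { intros E. apply HL. apply in_map_iff. exists m. split; [exact E|]. apply in_seq. lia. }
  destruct (Hg m) as (g & Hgu & Hgc).
  apply continuity_pt_eps. intros eps He.
  destruct (Hgc l Hl (y t) t eps) as (d1 & Hd1 & H1); [lra|exact He|].
  destruct (finite_delta k (fun j dl => forall l', (l' < d)%nat -> forall s, 0 <= s ->
     Rabs (s - t) < dl -> Rabs (y s j l' - y t j l') < d1)) as (d2 & Hd2 & H2).
  { intros j a b Hab H l' Hl' s Hs Hst. apply H; auto. lra. }
  { intros j Hj.
    apply (finite_delta d (fun l' dl => forall s, 0 <= s ->
       Rabs (s - t) < dl -> Rabs (y s j l' - y t j l') < d1)).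
    - intros l' a b Hab H s Hs Hst. apply H; auto. lra.
    - intros l' Hl'. destruct (Hy j l' Hj Hl' t d1) as (d2 & Hd2 & H2); [lra|exact Hd1|].
      exists d2. auto. }
  set (d3 := Rmin (t - r m) (r (S m) - t)).
  assert (Hd3 : 0 < d3) by (apply Rmin_pos; lra).
  exists (Rmin (Rmin d1 d2) d3). split; [apply Rmin_pos; [now apply Rmin_pos|exact Hd3]|].
  intros s Hs.
  assert (Hs1 : Rabs (s - t) < d1).
  { eapply Rlt_le_trans; [exact Hs|]. eapply Rle_trans; [apply Rmin_l|apply Rmin_l]. }
  assert (Hs2 : Rabs (s - t) < d2).
  { eapply Rlt_le_trans; [exact Hs|]. eapply Rle_trans; [apply Rmin_l|apply Rmin_r]. }
  assert (Hs3 : Rabs (s - t) < d3) by (eapply Rlt_le_trans; [exact Hs|apply Rmin_r]).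
  assert (Hsr : r m < s < r (S m)).
  { unfold d3 in Hs3. pose proof (Rmin_l (t - r m) (r (S m) - t)).
    pose proof (Rmin_r (t - r m) (r (S m) - t)). apply Rabs_def2 in Hs3. lra. }
  assert (Hr0m : forall p, 0 <= r p).
  { induction p as [|p IHp]; [lra|]. specialize (Hr p). lra. }
  rewrite <- !Hgu by lra. apply H1; auto; try lra.
  intros j l' Hj Hl'. apply H2; auto. specialize (Hr0m m). lra.
Qed.

Lemma znorm_nonneg n k d u w y t : 0 <= znorm n k d u w y t.
Proof. apply sqrt_pos. Qed.

Lemma sum_sqr_nonneg m d (f : nat -> nat -> R) :
  0 <= sumR m (fun i => sumR d (fun l => f i l ^ 2)).
Proof. apply sumR_nonneg. intros. apply sumR_nonneg. intros. apply pow2_ge_0. Qed.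

Lemma leader_input_le_znorm n k d u w y t v j : (j < k)%nat ->
  sumR d (fun l => v l ^ 2) <= 1 -> dot d v (u j (y t) t) <= znorm n k d u w y t.
Proof.
  intros Hj Hv. eapply Rle_trans; [apply dot_le_vnorm, Hv|].
  apply sqrt_le_1_alt.
  pose proof (sum_sqr_nonneg n d (fun i l => w i t l)).
  pose proof (sumR_ge_term k (fun j => sumR d (fun l => u j (y t) t l ^ 2)) j) as H1.
  cbv beta in H1. assert (forall j, (j < k)%nat -> 0 <= sumR d (fun l => u j (y t) t l ^ 2))
    by (intros; apply sumR_nonneg; intros; apply pow2_ge_0).
  specialize (H1 H0 Hj). cbv beta in H. lra.
Qed.

Lemma disturbance_le_znorm n k d u w y t v i : (i < n)%nat ->
  sumR d (fun l => v l ^ 2) <= 1 -> dot d v (w i t) <= znorm n k d u w y t.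
Proof.
  intros Hi Hv. eapply Rle_trans; [apply dot_le_vnorm, Hv|].
  apply sqrt_le_1_alt.
  pose proof (sum_sqr_nonneg k d (fun j l => u j (y t) t l)).
  pose proof (sumR_ge_term n (fun i => sumR d (fun l => w i t l ^ 2)) i) as H1.
  cbv beta in H1. assert (forall i, (i < n)%nat -> 0 <= sumR d (fun l => w i t l ^ 2))
    by (intros; apply sumR_nonneg; intros; apply pow2_ge_0).
  specialize (H1 H0 Hi). cbv beta in H. lra.
Qed.

Lemma znorm_continuity n k d u w y T :
  (forall j, (j < k)%nat -> admissible_u k d (u j)) ->
  admissible_w n d w ->
  (forall j l, (j < k)%nat -> (l < d)%nat -> cont_nonneg (fun s => y s j l)) ->
  exists L : list R, forall t, 0 < t < T -> ~ In t L -> continuity_pt (znorm n k d u w y) t.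
Proof.
  intros Hu Hw Hy.
  destruct (finite_list k (fun j L => forall t, 0 < t < T -> ~ In t L ->
     forall l, (l < d)%nat -> continuity_pt (fun s => u j (y s) s l) t)) as [L HL].
  { intros j L L' Hinc H t Ht Hn. apply H; auto. }
  { intros j Hj. apply (admissible_u_continuity k d (u j) y T); auto. }
  exists L. intros t Ht Hn.
  assert (Hsq : forall f : R -> R, continuity_pt f t -> continuity_pt (fun s => f s ^ 2) t).
  { intros f Hf. apply (continuity_pt_ext (fun s => f s * f s)); [intros; simpl; ring|].
    now apply continuity_pt_mult. }
  unfold znorm.
  apply (continuity_pt_comp (fun s => sumR k (fun j => sumR d (fun l => u j (y s) s l ^ 2))
        + sumR n (fun i => sumR d (fun l => w i s l ^ 2))) sqrt).
  - apply continuity_pt_plus.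
    + apply (continuity_pt_sumR k (fun j s => sumR d (fun l => u j (y s) s l ^ 2))).
      intros j Hj. apply (continuity_pt_sumR d (fun l s => u j (y s) s l ^ 2)).
      intros l Hl. apply Hsq. apply HL; auto.
    + apply (continuity_pt_sumR n (fun j s => sumR d (fun l => w j s l ^ 2))).
      intros j Hj. apply (continuity_pt_sumR d (fun l s => w j s l ^ 2)).
      intros l Hl. apply Hsq. apply (Hw j l Hj Hl).
  - apply continuity_pt_sqrt.
    apply Rplus_le_le_0_compat; apply sum_sqr_nonneg.
Qed.

(** Integrability is known on [[0, T]] only, so the integrand is extended by 0; its primitive is
    then continuous on the whole line. *)
Lemma integral_primitive (f : R -> R) T : 0 <= T -> ex_RInt f 0 T ->
  exists G, continuity G /\ G 0 = 0 /\ G T = RInt f 0 T /\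
    forall t, 0 < t < T -> continuity_pt f t -> derivable_pt_lim G t (f t).
Proof.
  intros HT Hf.
  set (h := fun s => if Rle_dec 0 s then if Rle_dec s T then f s else 0 else 0).
  assert (Hin : forall s, 0 <= s <= T -> h s = f s).
  { intros s Hs. unfold h. destruct (Rle_dec 0 s), (Rle_dec s T); lra. }
  assert (Hout : forall s, s < 0 \/ T < s -> h s = 0).
  { intros s Hs. unfold h. destruct (Rle_dec 0 s), (Rle_dec s T); lra. }
  assert (HfT : ex_RInt h 0 T).
  { apply (ex_RInt_ext f); [|exact Hf]. rewrite Rmin_left, Rmax_right by lra.
    intros x Hx. symmetry. apply Hin. lra. }
  assert (Hex : forall s, ex_RInt h 0 s).
  { intros s. destruct (Rle_dec 0 s) as [H0|H0].
    - destruct (Rle_dec s T) as [H1|H1].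
      + apply (ex_RInt_Chasles_1 h 0 s T); [lra|exact HfT].
      + apply (ex_RInt_Chasles h 0 T s); [exact HfT|].
        apply (ex_RInt_ext (fun _ => 0)); [|apply ex_RInt_const].
        rewrite Rmin_left, Rmax_right by lra. intros x Hx. symmetry. apply Hout. lra.
    - apply (ex_RInt_ext (fun _ => 0)); [|apply ex_RInt_const].
      rewrite Rmin_right, Rmax_left by lra. intros x Hx. symmetry. apply Hout. lra. }
  exists (fun s => RInt h 0 s).
  assert (Hloc : forall s, locally s (fun x => is_RInt h 0 x (RInt h 0 x))).
  { intros s. exists (mkposreal 1 Rlt_0_1). intros x _. apply (RInt_correct h 0 x), Hex. }
  split; [|split; [|split]].
  - intros s. apply continuity_pt_filterlim. apply (continuous_RInt_1 h 0 s (fun s => RInt h 0 s)), Hloc.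
  - apply (RInt_point 0 h).
  - apply RInt_ext. rewrite Rmin_left, Rmax_right by lra. intros x Hx. apply Hin. lra.
  - intros t Ht Hc. apply is_derive_Reals. rewrite <- Hin by lra.
    apply (is_derive_RInt h (fun s => RInt h 0 s) 0 t); [apply Hloc|].
    apply continuity_pt_filterlim. apply (continuity_pt_local f h t (Rmin t (T - t))).
    + apply Rmin_pos; lra.
    + intros s Hs. symmetry. apply Hin. pose proof (Rmin_l t (T - t)).
      pose proof (Rmin_r t (T - t)). apply Rabs_def2 in Hs. lra.
    + exact Hc.
Qed.

(** * Joint connectivity implies stability *)

Lemma dot_scal_sum d v m (c : nat -> R) (z : nat -> nat -> R) :
  dot d v (fun l => sumR m (fun j => c j * z j l)) = sumR m (fun j => c j * dot d v (z j)).
Proof.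
  unfold dot.
  rewrite (sumR_ext d _ (fun l => sumR m (fun j => c j * (v l * z j l)))).
  - rewrite sumR_swap. apply sumR_ext. intros. now rewrite sumR_scal.
  - intros l _. rewrite <- sumR_scal. apply sumR_ext. intros; ring.
Qed.

Lemma dot_plus d v x y : dot d v (fun l => x l + y l) = dot d v x + dot d v y.
Proof.
  unfold dot. rewrite <- sumR_plus. apply sumR_ext. intros; ring.
Qed.

Lemma dot_opp d v x : dot d (fun l => - v l) x = - dot d v x.
Proof. unfold dot. rewrite <- sumR_opp. apply sumR_ext. intros; ring. Qed.

Lemma dot_extend_continuity d v (x : R -> nat -> R) :
  (forall l, (l < d)%nat -> cont_nonneg (fun s => x s l)) ->
  continuity (fun s => dot d v (x (Rmax 0 s))).
Proof.
  intros H t. apply (continuity_pt_sumR d (fun l s => v l * x (Rmax 0 s) l)).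
  intros l Hl. apply (continuity_pt_scal (fun s => x (Rmax 0 s) l)).
  apply (cont_nonneg_extend (fun s => x s l)), H, Hl.
Qed.

Lemma dot_extend_derivable d v (x : R -> nat -> R) dx t : 0 < t ->
  (forall l, (l < d)%nat -> derivable_pt_lim (fun s => x s l) t (dx l)) ->
  derivable_pt_lim (fun s => dot d v (x (Rmax 0 s))) t (dot d v dx).
Proof.
  intros Ht H. apply (derivable_pt_lim_sumR d (fun l s => v l * x (Rmax 0 s) l)).
  intros l Hl. apply (derivable_pt_lim_scal (fun s => x (Rmax 0 s) l)).
  apply (derivable_pt_lim_extend (fun s => x s l)); auto.
Qed.

(** The projected speed of a leader is at most [|z|], the derivative of [G]. Used with [v] to keep
    leaders below [c + G], and with the opposite direction to bound how far a leader has receded at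
    the final time. *)
Lemma leader_drift k d n u w (y : R -> Vecs) v G L j T :
  (j < k)%nat -> sumR d (fun l => v l ^ 2) <= 1 ->
  (forall l, (l < d)%nat -> cont_nonneg (fun s => y s j l)) ->
  continuity G -> G 0 = 0 ->
  (forall t, 0 < t < T -> ~ In t L ->
     derivable_pt_lim G t (znorm n k d u w y t) /\
     forall l, (l < d)%nat -> derivable_pt_lim (fun s => y s j l) t (u j (y t) t l)) ->
  forall t, 0 <= t <= T -> dot d v (y t j) <= dot d v (y 0 j) + G t.
Proof.
  intros Hj Hv Hy HG HG0 Hd t Ht.
  pose proof (nonincreasing_except L (fun s => dot d v (y (Rmax 0 s) j) - G s) 0 t) as K.
  cbv beta in K. rewrite (Rmax_right 0 t), (Rmax_left 0 0), HG0 in K by lra.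
  assert (K2 : dot d v (y t j) - G t <= dot d v (y 0 j) - 0); [|lra].
  apply K; [lra| |].
  - intros s _. apply (continuity_minus (fun s => dot d v (y (Rmax 0 s) j))); [|exact HG].
    apply (dot_extend_continuity d v (fun s => y s j)). exact Hy.
  - intros s Hs HL. destruct (Hd s ltac:(lra) HL) as [H1 H2].
    exists (dot d v (u j (y s) s) - znorm n k d u w y s). split.
    + apply (derivable_pt_lim_minus (fun s => dot d v (y (Rmax 0 s) j))); [|exact H1].
      apply (dot_extend_derivable d v (fun s => y s j)); [lra|exact H2].
    + pose proof (leader_input_le_znorm n k d u w y s v j Hj Hv). lra.
Qed.

(** Subtracting [G] pays for the disturbance and, by [leader_drift], also makes every shifted leader
    nonpositive. Each leader term is then at most [- bb j] times the shifted follower, and the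
    damping is the sum of the active leader weights. *)
Lemma projection_subsolution n k d sigma a b u w x y a_lo a_hi b_lo v c G L T :
  0 < b_lo ->
  (forall i j x y t, (i < n)%nat -> (j < n)%nat -> a_lo <= a i j x y t <= a_hi) ->
  (forall i j x y t, (i < n)%nat -> (j < k)%nat -> b_lo <= b i j x y t) ->
  sumR d (fun l => v l ^ 2) <= 1 ->
  (forall i l, (i < n)%nat -> (l < d)%nat -> cont_nonneg (fun s => x s i l)) ->
  (forall j l, (j < k)%nat -> (l < d)%nat -> cont_nonneg (fun s => y s j l)) ->
  continuity G -> G 0 = 0 ->
  (forall t, 0 < t < T -> ~ In t L ->
     derivable_pt_lim G t (znorm n k d u w y t) /\
     (forall j l, (j < k)%nat -> (l < d)%nat ->
         derivable_pt_lim (fun s => y s j l) t (u j (y t) t l)) /\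
     (forall i l, (i < n)%nat -> (l < d)%nat ->
         derivable_pt_lim (fun s => x s i l) t
           (follower_rhs n k sigma a b w (x t) (y t) t i l))) ->
  (forall j, (j < k)%nat -> dot d v (y 0 j) <= c) ->
  subsolution n k sigma a_lo a_hi b_lo T
    (fun i s => dot d v (x (Rmax 0 s) i) - c - G s).
Proof.
  intros Hb Hab Hbb Hv Hx Hy HG HG0 Hd Hc. split.
  - intros i Hi. apply (continuity_minus (fun s => dot d v (x (Rmax 0 s) i) - c)); [|exact HG].
    apply (continuity_minus (fun s => dot d v (x (Rmax 0 s) i)) (fun _ => c)).
    + apply (dot_extend_continuity d v (fun s => x s i)). auto.
    + apply continuity_const. intros ? ?; reflexivity.
  - exists L. intros t Ht HL i Hi.
    destruct (Hd t Ht HL) as (HdG & Hdy & Hdx).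
    set (al := fun j => if sigma t (FN j) (FN i) then a i j (x t) (y t) t else 0).
    set (bb := fun j => if sigma t (LN j) (FN i) then b i j (x t) (y t) t else 0).
    assert (Hbb0 : forall j, (j < k)%nat -> 0 <= bb j).
    { intros j Hj. unfold bb. destruct (sigma t (LN j) (FN i)); [|lra].
      specialize (Hbb i j (x t) (y t) t Hi Hj). lra. }
    exists (dot d v (follower_rhs n k sigma a b w (x t) (y t) t i) - 0 - znorm n k d u w y t),
      al, (sumR k bb).
    repeat split.
    + apply (derivable_pt_lim_minus (fun s => dot d v (x (Rmax 0 s) i) - c)); [|exact HdG].
      apply (derivable_pt_lim_minus (fun s => dot d v (x (Rmax 0 s) i)) (fun _ => c));
        [|apply derivable_pt_lim_const].
      apply (dot_extend_derivable d v (fun s => x s i)); [lra|auto].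
    + intros j Hj. unfold al. destruct (sigma t (FN j) (FN i)); [auto|reflexivity].
    + apply sumR_nonneg, Hbb0.
    + intros j Hj Hij. apply Rle_trans with (bb j).
      * unfold bb. rewrite Hij. auto.
      * now apply sumR_ge_term.
    + rewrite Rmax_right by lra.
      assert (E : dot d v (follower_rhs n k sigma a b w (x t) (y t) t i)
        = sumR n (fun j => al j * (dot d v (x t j) - dot d v (x t i)))
          + sumR k (fun j => bb j * (dot d v (y t j) - dot d v (x t i))) + dot d v (w i t)).
      { rewrite (sumR_ext n _ (fun j => al j * dot d v (fun l => x t j l - x t i l)))
          by (intros; now rewrite dot_minus).
        rewrite (sumR_ext k _ (fun j => bb j * dot d v (fun l => y t j l - x t i l)))
          by (intros; now rewrite dot_minus).
        rewrite <- (dot_scal_sum d v n al (fun j l => x t j l - x t i l)).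
        rewrite <- (dot_scal_sum d v k bb (fun j l => y t j l - x t i l)).
        rewrite <- !dot_plus. unfold dot. apply sumR_ext. intros l _. f_equal.
        unfold follower_rhs, al, bb. f_equal. f_equal; apply sumR_ext; intros j _.
        - destruct (sigma t (FN j) (FN i)); ring.
        - destruct (sigma t (LN j) (FN i)); ring. }
      rewrite E.
      pose proof (disturbance_le_znorm n k d u w y t v i Hi Hv) as Hw.
      assert (Hs1 : sumR n (fun j => al j * (dot d v (x t j) - dot d v (x t i)))
        = sumR n (fun j => al j * (dot d v (x t j) - c - G t - (dot d v (x t i) - c - G t)))).
      { apply sumR_ext. intros j _. ring. }
      rewrite Hs1.
      assert (Hs2 : sumR k (fun j => bb j * (dot d v (y t j) - dot d v (x t i)))
         <= - (sumR k bb * (dot d v (x t i) - c - G t))).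
      { rewrite Rmult_comm, <- sumR_scal, <- sumR_opp. apply sumR_le. intros j Hj.
        assert (dot d v (y t j) <= dot d v (y 0 j) + G t).
        { apply (leader_drift k d n u w y v G L j T); auto; [|lra].
          intros s Hs HLs. destruct (Hd s Hs HLs) as (? & ? & ?). split; auto. }
        specialize (Hc j Hj). specialize (Hbb0 j Hj). nra. }
      lra.
Qed.

Lemma JLC_SiISS n k d sigma tauD a b a_lo a_hi b_lo :
  (1 <= k)%nat ->
  (forall t v j, 0 <= t -> valid_node n k v -> (j < k)%nat -> sigma t v (LN j) = false) ->
  dwell_time sigma tauD ->
  0 < a_lo -> a_lo <= a_hi -> 0 < b_lo ->
  (forall i j x y t, (i < n)%nat -> (j < n)%nat -> a_lo <= a i j x y t <= a_hi) ->
  (forall i j x y t, (i < n)%nat -> (j < k)%nat -> b_lo <= b i j x y t) ->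
  (forall t, 0 <= t -> forall i j, (i < n)%nat -> (j < n)%nat ->
     sigma t (FN i) (FN j) = sigma t (FN j) (FN i)) ->
  JLC n k sigma -> SiISS n k d sigma a b.
Proof.
  intros Hk Hlead (Htau & s & Hs0 & Hs & Hsig) Ha Hah Hb Hab Hbb Hbi HJ.
  destruct (decay_profile (decay_bound n k sigma a_lo a_hi b_lo)) as (phi & Hphi & Hmon & Hlim).
  (* The constant 1 is admissible at every time by the maximum principle. *)
  { intros t Ht. exists 1. split; [lra|]. intros T X M Hsub HT HM H0.
    rewrite Rmult_1_l.
    apply (subsolution_max n k sigma a_lo a_hi b_lo T X 0 T); auto; lra. }
  { intros t c [H _]. exact H. }
  { intros t t' c Htt [H1 H2]. split; [exact H1|]. intros T X M Hsub HT. apply H2; [exact Hsub|lra]. }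
  { intros t c c' Hcc [H1 H2]. split; [lra|]. intros T X M Hsub HT HM H0 i Hi.
    specialize (H2 T X M Hsub HT HM H0 i Hi). nra. }
  { apply (decay_bound_small n k sigma a_lo a_hi b_lo s tauD); auto. }
  (* The slope 2 counts [|z|] twice: once for the shift [G], once for the displacement of the
     reference leader. *)
  exists (fun r t => r * phi t), (fun r => 2 * r). split; [|split].
  - split.
    + intros t Ht. destruct (Hphi t Ht) as [Hp _]. split; [ring|split].
      * intros r r' _ Hr. apply Rmult_lt_compat_r; assumption.
      * intros r eps Hr He. exists (eps / phi t). split; [now apply Rdiv_lt_0_compat|].
        intros r' _ Hd. rewrite <- Rmult_minus_distr_r, Rabs_mult, (Rabs_pos_eq (phi t)) by lra.
        apply (Rmult_lt_compat_r (phi t)) in Hd; [|exact Hp].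
        unfold Rdiv in Hd. rewrite Rmult_assoc, Rinv_l in Hd; lra.
    + intros r Hr. split.
      * intros s1 s2 H1 H2. apply Rmult_le_compat_l; auto.
      * intros eps He. destruct (Hlim (eps / (r + 1))) as (T & HT & H).
        { apply Rdiv_lt_0_compat; lra. }
        exists T. intros t Ht. specialize (H t Ht).
        destruct (Hphi t) as [Hp _]; [lra|].
        apply (Rmult_lt_compat_r (r + 1)) in H; [|lra].
        unfold Rdiv in H. rewrite Rmult_assoc, Rinv_l in H; nra.
  - split; [ring|split].
    + intros; lra.
    + intros t eps _ He. exists (eps / 2). split; [lra|]. intros r _ Hr.
      rewrite <- Rmult_minus_distr_l, Rabs_mult, (Rabs_pos_eq 2); lra.
  - intros u w x y Hu Hw (Hx & Hy & D & HD & Hode) T HT pr.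
    rewrite <- RInt_Reals.
    pose proof (ex_RInt_Reals_1 _ _ _ pr) as Hex2.
    assert (Hex : ex_RInt (znorm n k d u w y) 0 T).
    { apply (ex_RInt_ext (fun r => scal (/ 2) (2 * znorm n k d u w y r))).
      - intros r _. unfold scal; simpl; unfold mult; simpl. field.
      - apply (ex_RInt_scal (V := R_NormedModule)), Hex2. }
    assert (HI : RInt (fun r => 2 * znorm n k d u w y r) 0 T = 2 * RInt (znorm n k d u w y) 0 T).
    { exact (RInt_scal (V := R_CompleteNormedModule) (znorm n k d u w y) 0 T 2 Hex). }
    destruct (integral_primitive _ T HT Hex) as (G & HG & HG0 & HGT & HdG).
    destruct (znorm_continuity n k d u w y T) as (L1 & HL1); auto.
    destruct (HD T) as (L2 & HL2).
    assert (Hall : forall t, 0 < t < T -> ~ In t (L1 ++ L2) ->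
     derivable_pt_lim G t (znorm n k d u w y t) /\
     (forall j l, (j < k)%nat -> (l < d)%nat ->
         derivable_pt_lim (fun s => y s j l) t (u j (y t) t l)) /\
     (forall i l, (i < n)%nat -> (l < d)%nat ->
         derivable_pt_lim (fun s => x s i l) t
           (follower_rhs n k sigma a b w (x t) (y t) t i l))).
    { intros t Ht Hn. split.
      - apply HdG; [exact Ht|]. apply HL1; [exact Ht|]. intros H. apply Hn, in_or_app. auto.
      - apply Hode; [lra|]. intros H. apply Hn, in_or_app. right. apply HL2; [exact H|lra]. }
    destruct (Hphi T HT) as [Hp [_ Hdecay]].
    assert (HGT0 : 0 <= G T).
    { pose proof (nonincreasing_except L1 (fun s => - G s) 0 T HT) as K. cbv beta in K.
      rewrite HG0 in K. assert (- G T <= - 0); [|lra]. apply K.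
      - intros t _. apply (continuity_pt_opp G), HG.
      - intros t Ht Hn. exists (- znorm n k d u w y t). split.
        + apply derivable_pt_lim_opp. apply HdG; auto.
        + pose proof (znorm_nonneg n k d u w y t). lra. }
    set (M0 := set_dist n k d (x 0) (y 0)).
    assert (HM0 : 0 <= M0) by apply maxR_nonneg.
    rewrite HI, <- HGT. apply maxR_le.
    { assert (0 <= M0 * phi T) by (apply Rmult_le_pos; lra). lra. }
    intros i Hi. apply le_epsilon. intros delta Hdelta.
    (* The direction is read off at the final time, which is allowed because [phi] serves all
       directions. The leader [j] extremal at time 0 fixes the shift and is later compared with its
       own position at [T]. *)
    destruct (hull_dist_separate k d (y T) (x T i) delta Hk Hdelta) as (v & Hv & Hsep).
    destruct (argmax_exists k (fun j => dot d v (y 0 j)) Hk) as (j & Hj & Hmax).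
    pose proof (projection_subsolution n k d sigma a b u w x y a_lo a_hi b_lo v
      (dot d v (y 0 j)) G (L1 ++ L2) T Hb Hab Hbb Hv Hx Hy HG HG0 Hall Hmax) as Hsub.
    assert (HX : dot d v (x (Rmax 0 T) i) - dot d v (y 0 j) - G T <= phi T * M0).
    { apply (Hdecay T (fun i s => dot d v (x (Rmax 0 s) i) - dot d v (y 0 j) - G s) M0 Hsub);
        auto; [lra|].
      intros i' Hi'. rewrite Rmax_left, HG0 by lra.
      assert (dot d v (x 0 i') - dot d v (y 0 j) <= hull_dist k d (y 0) (x 0 i'))
        by (apply hull_dist_support; auto).
      assert (hull_dist k d (y 0) (x 0 i') <= M0)
        by (apply (maxR_ge n (fun i => hull_dist k d (y 0) (x 0 i))), Hi').
      lra. }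
    rewrite Rmax_right in HX by lra.
    assert (Hdrift : dot d (fun l => - v l) (y T j) <= dot d (fun l => - v l) (y 0 j) + G T).
    { apply (leader_drift k d n u w y _ G (L1 ++ L2) j T); auto; [| |lra].
      - rewrite (sumR_ext d _ (fun l => v l ^ 2)) by (intros; ring). exact Hv.
      - intros t Ht Hn. destruct (Hall t Ht Hn) as (? & ? & ?). split; auto. }
    rewrite !dot_opp in Hdrift. specialize (Hsep j Hj). lra.
Qed.

(** * Approximate solutions of continuous differential equations *)

(** Functions of [n] real variables and time are encoded on sequences; constraining only the indices
    below [n] forces independence of the other coordinates. *)
Definition jcont (n : nat) (h : (nat -> R) -> R -> R) : Prop :=
  forall xi t eps, 0 < eps -> exists delta, 0 < delta /\
    forall xi' t', (forall i, (i < n)%nat -> Rabs (xi' i - xi i) < delta) ->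
      Rabs (t' - t) < delta -> Rabs (h xi' t' - h xi t) < eps.

Lemma jcont_const n c : jcont n (fun _ _ => c).
Proof.
  intros xi t eps He. exists 1. split; [lra|]. intros. now rewrite Rminus_diag, Rabs_R0.
Qed.

Lemma jcont_coord n i : (i < n)%nat -> jcont n (fun xi _ => xi i).
Proof. intros Hi xi t eps He. exists eps. split; auto. Qed.

Lemma jcont_plus n f g : jcont n f -> jcont n g -> jcont n (fun xi t => f xi t + g xi t).
Proof.
  intros Hf Hg xi t eps He.
  destruct (Hf xi t (eps / 2)) as (d1 & Hd1 & H1); [lra|].
  destruct (Hg xi t (eps / 2)) as (d2 & Hd2 & H2); [lra|].
  exists (Rmin d1 d2). split; [now apply Rmin_pos|]. intros xi' t' Hx Ht.
  pose proof (Rmin_l d1 d2). pose proof (Rmin_r d1 d2).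
  assert (A1 : Rabs (f xi' t' - f xi t) < eps / 2)
    by (apply H1; [intros i Hi; specialize (Hx i Hi)|]; lra).
  assert (A2 : Rabs (g xi' t' - g xi t) < eps / 2)
    by (apply H2; [intros i Hi; specialize (Hx i Hi)|]; lra).
  apply Rabs_def2 in A1. apply Rabs_def2 in A2. apply Rabs_def1; lra.
Qed.

Lemma jcont_mult n f g : jcont n f -> jcont n g -> jcont n (fun xi t => f xi t * g xi t).
Proof.
  intros Hf Hg xi t eps He.
  set (A := Rabs (f xi t) + 1). set (B := Rabs (g xi t) + 1).
  assert (HA : 0 < A) by (pose proof (Rabs_pos (f xi t)); unfold A; lra).
  assert (HB : 0 < B) by (pose proof (Rabs_pos (g xi t)); unfold B; lra).
  destruct (Hf xi t (Rmin 1 (eps / (2 * B)))) as (d1 & Hd1 & H1).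
  { apply Rmin_pos; [lra|]. apply Rdiv_lt_0_compat; lra. }
  destruct (Hg xi t (eps / (2 * A))) as (d2 & Hd2 & H2).
  { apply Rdiv_lt_0_compat; lra. }
  exists (Rmin d1 d2). split; [now apply Rmin_pos|]. intros xi' t' Hx Ht.
  pose proof (Rmin_l d1 d2). pose proof (Rmin_r d1 d2).
  assert (A1 : Rabs (f xi' t' - f xi t) < Rmin 1 (eps / (2 * B)))
    by (apply H1; [intros i Hi; specialize (Hx i Hi)|]; lra).
  assert (A2 : Rabs (g xi' t' - g xi t) < eps / (2 * A))
    by (apply H2; [intros i Hi; specialize (Hx i Hi)|]; lra).
  pose proof (Rmin_l 1 (eps / (2 * B))). pose proof (Rmin_r 1 (eps / (2 * B))).
  replace (f xi' t' * g xi' t' - f xi t * g xi t)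
    with (f xi' t' * (g xi' t' - g xi t) + (f xi' t' - f xi t) * g xi t) by ring.
  eapply Rle_lt_trans; [apply Rabs_triang|]. rewrite !Rabs_mult.
  assert (Hf' : Rabs (f xi' t') <= A).
  { replace (f xi' t') with (f xi t + (f xi' t' - f xi t)) by ring.
    eapply Rle_trans; [apply Rabs_triang|]. unfold A. lra. }
  assert (Rabs (f xi' t') * Rabs (g xi' t' - g xi t) <= eps / 2).
  { apply Rle_trans with (A * (eps / (2 * A))).
    - apply Rmult_le_compat; try apply Rabs_pos; lra.
    - right. field. lra. }
  assert (Rabs (f xi' t' - f xi t) * Rabs (g xi t) < eps / 2).
  { apply Rle_lt_trans with (eps / (2 * B) * Rabs (g xi t)).
    - apply Rmult_le_compat_r; [apply Rabs_pos|lra].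
    - apply Rlt_le_trans with (eps / (2 * B) * B).
      + apply Rmult_lt_compat_l; [apply Rdiv_lt_0_compat; lra|unfold B; lra].
      + right. field. lra. }
  lra.
Qed.

Lemma jcont_sumR n m (f : nat -> (nat -> R) -> R -> R) :
  (forall j, (j < m)%nat -> jcont n (f j)) -> jcont n (fun xi t => sumR m (fun j => f j xi t)).
Proof.
  induction m as [|m IH]; intros H; simpl; [apply jcont_const|].
  apply (jcont_plus n (fun xi t => sumR m (fun j => f j xi t)) (f m)).
  - apply IH. intros; apply H; lia.
  - apply H; lia.
Qed.

(** * Compactness of a box *)

Fixpoint to_Tn (n : nat) (x : nat -> R) : Compactness.Tn n R :=
  match n with
  | O => tt
  | S n' => (x O, to_Tn n' (fun i => x (S i)))
  end.

Fixpoint of_Tn (n : nat) : Compactness.Tn n R -> nat -> R :=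
  match n with
  | O => fun _ _ => 0
  | S n' => fun p i => match i with O => fst p | S i' => of_Tn n' (snd p) i' end
  end.

Lemma to_Tn_bounded n : forall lo hi x,
  (forall i, (i < n)%nat -> lo i <= x i <= hi i) ->
  Compactness.bounded_n n (to_Tn n lo) (to_Tn n hi) (to_Tn n x).
Proof.
  induction n as [|n IH]; intros lo hi x H; simpl; [exact I|].
  split; [apply H; lia|]. apply IH. intros. apply H. lia.
Qed.

Lemma of_Tn_close n : forall d x p,
  Compactness.close_n n d (to_Tn n x) p ->
  forall i, (i < n)%nat -> Rabs (x i - of_Tn n p i) < d.
Proof.
  induction n as [|n IH]; intros d x p H i Hi; [lia|].
  destruct p as [p0 p]. simpl in H. destruct H as [H0 H]. destruct i as [|i]; simpl; [exact H0|].
  apply (IH d (fun i => x (S i)) p H). lia.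
Qed.

Definition box (n : nat) (t0 : R) (xi : nat -> R) (t : R) : Prop :=
  (forall i, (i < n)%nat -> -1 <= xi i <= 1) /\ 0 <= t <= t0.

(** Compactness in gauge form: every point of the box lies within the gauge of some tag at which the
    gauge is at least a common [d]. The library statement is doubly negated, hence [NNPP]. *)
Lemma box_gauge n t0 (delta : (nat -> R) -> R -> posreal) :
  exists d : posreal, forall xi t, box n t0 xi t ->
    exists xi' t', (forall i, (i < n)%nat -> Rabs (xi i - xi' i) < delta xi' t') /\
      Rabs (t - t') < delta xi' t' /\ d <= delta xi' t'.
Proof.
  destruct (Compactness.compactness_value (S n)
    (0, to_Tn n (fun _ => -1)) (t0, to_Tn n (fun _ => 1))
    (fun p => delta (of_Tn n (snd p)) (fst p))) as [d Hd].
  exists d. intros xi t [Hxi Ht].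
  specialize (Hd (t, to_Tn n xi)). apply NNPP in Hd.
  - destruct Hd as ([t' p] & Hb & [Hc0 Hc] & Hle). simpl in Hc0, Hc, Hle.
    exists (of_Tn n p), t'. split; [|split; [exact Hc0|exact Hle]].
    apply (of_Tn_close n). exact Hc.
  - split; [exact Ht|]. apply to_Tn_bounded. exact Hxi.
Qed.

Lemma jcont_gauge n h : jcont n h -> forall eps, 0 < eps ->
  exists delta : (nat -> R) -> R -> posreal, forall xi t xi' t',
    (forall i, (i < n)%nat -> Rabs (xi' i - xi i) < delta xi t) ->
    Rabs (t' - t) < delta xi t -> Rabs (h xi' t' - h xi t) < eps.
Proof.
  intros Hh eps He.
  assert (K : forall xi t, {delta : posreal | forall xi' t',
    (forall i, (i < n)%nat -> Rabs (xi' i - xi i) < delta) ->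
    Rabs (t' - t) < delta -> Rabs (h xi' t' - h xi t) < eps}).
  { intros xi t. apply constructive_indefinite_description.
    destruct (Hh xi t eps He) as (d & Hd & H). exists (mkposreal d Hd). exact H. }
  exists (fun xi t => proj1_sig (K xi t)). intros xi t. exact (proj2_sig (K xi t)).
Qed.

Lemma jcont_bounded n t0 h : jcont n h ->
  exists B, forall xi t, box n t0 xi t -> Rabs (h xi t) <= B.
Proof.
  intros Hh. destruct (jcont_gauge n h Hh 1 Rlt_0_1) as [delta Hdelta].
  (* The second entry encodes the size of [h] at the tag: a lower bound on the gauge becomes an
     upper bound on [|h|] there. *)
  assert (Hpos : forall xi t, 0 < Rmin (delta xi t) (/ (1 + Rabs (h xi t)))).
  { intros xi t. apply Rmin_pos; [apply cond_pos|]. apply Rinv_0_lt_compat.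
    pose proof (Rabs_pos (h xi t)). lra. }
  destruct (box_gauge n t0 (fun xi t => mkposreal _ (Hpos xi t))) as [d Hd].
  exists (/ d + 1). intros xi t Hb. destruct (Hd xi t Hb) as (xi' & t' & H1 & H2 & H3).
  simpl in H1, H2, H3.
  pose proof (Rmin_l (delta xi' t') (/ (1 + Rabs (h xi' t')))).
  pose proof (Rmin_r (delta xi' t') (/ (1 + Rabs (h xi' t')))).
  assert (Hc : Rabs (h xi t - h xi' t') < 1).
  { apply Hdelta; [intros i Hi; specialize (H1 i Hi)|]; lra. }
  assert (Hh' : 1 + Rabs (h xi' t') <= / d).
  { rewrite <- (Rinv_inv (1 + _)). apply Rinv_le_contravar; [apply cond_pos|lra]. }
  replace (h xi t) with ((h xi t - h xi' t') + h xi' t') by ring.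
  eapply Rle_trans; [apply Rabs_triang|]. lra.
Qed.

Lemma jcont_uniform n t0 h : jcont n h -> forall eps, 0 < eps ->
  exists d, 0 < d /\ forall xi t xi' t', box n t0 xi t ->
    (forall i, (i < n)%nat -> Rabs (xi' i - xi i) < d) -> Rabs (t' - t) < d ->
    Rabs (h xi' t' - h xi t) < eps.
Proof.
  intros Hh eps He. destruct (jcont_gauge n h Hh (eps / 2)) as [delta Hdelta]; [lra|].
  (* Half the gauge leaves room for the second point, which may lie outside the box. *)
  assert (Hpos : forall xi t, 0 < delta xi t / 2).
  { intros xi t. pose proof (cond_pos (delta xi t)). lra. }
  destruct (box_gauge n t0 (fun xi t => mkposreal _ (Hpos xi t))) as [d Hd].
  exists d. split; [apply cond_pos|]. intros xi t xi' t' Hb Hx Ht.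
  destruct (Hd xi t Hb) as (xc & tc & H1 & H2 & H3). simpl in H1, H2, H3.
  assert (A1 : Rabs (h xi t - h xc tc) < eps / 2).
  { pose proof (cond_pos (delta xc tc)).
    apply Hdelta; [intros i Hi; specialize (H1 i Hi)|]; lra. }
  assert (A2 : Rabs (h xi' t' - h xc tc) < eps / 2).
  { apply Hdelta.
    - intros i Hi. specialize (H1 i Hi). specialize (Hx i Hi).
      replace (xi' i - xc i) with ((xi' i - xi i) + (xi i - xc i)) by ring.
      eapply Rle_lt_trans; [apply Rabs_triang|]. lra.
    - replace (t' - tc) with ((t' - t) + (t - tc)) by ring.
      eapply Rle_lt_trans; [apply Rabs_triang|]. lra. }
  apply Rabs_def2 in A1. apply Rabs_def2 in A2. apply Rabs_def1; lra.
Qed.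

(** * Global uniformly continuous fields by clamping *)

Definition clamp (lo hi r : R) : R := Rmax lo (Rmin r hi).

Lemma clamp_range lo hi r : lo <= hi -> lo <= clamp lo hi r <= hi.
Proof.
  intros H. unfold clamp, Rmax, Rmin.
  destruct (Rle_dec r hi), (Rle_dec lo _); lra.
Qed.

Lemma clamp_id lo hi r : lo <= r <= hi -> clamp lo hi r = r.
Proof. intros H. unfold clamp. rewrite Rmin_left, Rmax_right; lra. Qed.

Lemma clamp_lipschitz lo hi r s : Rabs (clamp lo hi r - clamp lo hi s) <= Rabs (r - s).
Proof.
  pose proof (Rle_abs (r - s)) as H1. pose proof (Rle_abs (s - r)) as H2.
  rewrite (Rabs_minus_sym s r) in H2. pose proof (Rabs_pos (r - s)).
  apply Rabs_le. unfold clamp, Rmax, Rmin.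
  destruct (Rle_dec r hi), (Rle_dec s hi);
    repeat match goal with |- context [Rle_dec ?a ?b] => destruct (Rle_dec a b) end; lra.
Qed.

Lemma clamp_abs r : Rabs (clamp (-1) 1 r) <= Rabs r.
Proof.
  pose proof (clamp_lipschitz (-1) 1 r 0) as H.
  rewrite (clamp_id (-1) 1 0), !Rminus_0_r in H by lra. exact H.
Qed.

Definition ucont (n : nat) (F : (nat -> R) -> R -> nat -> R) : Prop :=
  forall eps, 0 < eps -> exists d, 0 < d /\ forall xi t xi' t',
    (forall i, (i < n)%nat -> Rabs (xi' i - xi i) < d) -> Rabs (t' - t) < d ->
    forall i, (i < n)%nat -> Rabs (F xi' t' i - F xi t i) < eps.

(** The clamped field agrees with [h] on the box but is uniformly continuous everywhere, so
    approximate solutions can be built before knowing where they stay. *)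
Lemma ucont_clamp n t0 (h : nat -> (nat -> R) -> R -> R) :
  0 <= t0 -> (forall i, (i < n)%nat -> jcont n (h i)) ->
  ucont n (fun xi t i => h i (fun j => clamp (-1) 1 (xi j)) (clamp 0 t0 t)).
Proof.
  intros Ht0 Hh eps He.
  destruct (finite_delta n (fun i d => forall xi t xi' t', box n t0 xi t ->
    (forall i, (i < n)%nat -> Rabs (xi' i - xi i) < d) -> Rabs (t' - t) < d ->
    Rabs (h i xi' t' - h i xi t) < eps)) as (d & Hd & H).
  { intros i d d' Hdd H xi t xi' t' Hb Hx Ht. apply H; auto; [|lra].
    intros j Hj. specialize (Hx j Hj). lra. }
  { intros i Hi. apply jcont_uniform; auto. }
  exists d. split; [exact Hd|]. intros xi t xi' t' Hx Ht i Hi. apply H; auto.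
  - split; [intros; apply clamp_range; lra|apply clamp_range; lra].
  - intros j Hj. eapply Rle_lt_trans; [apply clamp_lipschitz|auto].
  - eapply Rle_lt_trans; [apply clamp_lipschitz|auto].
Qed.

Lemma ucont_congr n F xi xi' t i : ucont n F ->
  (forall j, (j < n)%nat -> xi' j = xi j) -> (i < n)%nat -> F xi' t i = F xi t i.
Proof.
  intros HF E Hi. apply cond_eq. intros eps He.
  destruct (HF eps He) as (d & Hd & H). apply H; auto.
  - intros j Hj. rewrite E, Rminus_diag, Rabs_R0; auto.
  - rewrite Rminus_diag, Rabs_R0; auto.
Qed.

Lemma ucont_comp n F (x : R -> nat -> R) (m : R -> R) i : ucont n F -> (i < n)%nat ->
  (forall j, (j < n)%nat -> continuity (fun t => x t j)) -> continuity m ->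
  continuity (fun t => F (x (m t)) (m t) i).
Proof.
  intros HF Hi Hx Hm t. apply continuity_pt_eps. intros eps He.
  destruct (HF eps He) as (d & Hd & H).
  destruct (finite_delta n (fun j dl => forall s, Rabs (s - t) < dl ->
     Rabs (x (m s) j - x (m t) j) < d)) as (d1 & Hd1 & H1).
  { intros j a b Hab Hj s Hs. apply Hj. lra. }
  { intros j Hj.
    destruct (proj1 (continuity_pt_eps (fun s => x (m s) j) t)
      (continuity_pt_comp m (fun s => x s j) t (Hm t) (Hx j Hj (m t))) d Hd) as (a & Ha & Hs).
    exists a. auto. }
  destruct (proj1 (continuity_pt_eps m t) (Hm t) d Hd) as (d2 & Hd2 & H2).
  exists (Rmin d1 d2). split; [now apply Rmin_pos|]. intros s Hs.
  apply H; auto.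
  - intros j Hj. apply H1; auto. eapply Rlt_le_trans; [exact Hs|apply Rmin_l].
  - apply H2. eapply Rlt_le_trans; [exact Hs|apply Rmin_r].
Qed.

(** * Tonelli approximation from a terminal state *)

Lemma RInt_derivable (g : R -> R) q t : continuity g ->
  derivable_pt_lim (fun s => RInt g q s) t (g t).
Proof.
  intros Hg. apply is_derive_Reals.
  apply (is_derive_RInt g (fun s => RInt g q s) q t).
  - exists (mkposreal 1 Rlt_0_1). intros x _. apply (RInt_correct g q x).
    apply (ex_RInt_continuous g q x). intros z _. apply continuity_pt_filterlim, Hg.
  - apply continuity_pt_filterlim, Hg.
Qed.

(* Tonelli's method with an advanced argument: iterating the integral operator
   stabilises after finitely many steps on [[p, q]]. *)
Fixpoint tonelli (F : (nat -> R) -> R -> nat -> R) (q h : R) (xq eq : nat -> R) (K : nat)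
  : R -> nat -> R :=
  match K with
  | O => fun _ i => xq i
  | S K' => fun t i => xq i + RInt (fun s =>
      F (tonelli F q h xq eq K' (Rmin (s + h) q)) (Rmin (s + h) q) i + eq i) q t
  end.

Lemma continuity_Rmin_shift h q : continuity (fun s => Rmin (s + h) q).
Proof.
  intros t. apply continuity_pt_eps. intros eps He. exists eps. split; [exact He|].
  intros s Hs. apply Rabs_def2 in Hs. apply Rabs_def1; unfold Rmin;
    destruct (Rle_dec (s + h) q), (Rle_dec (t + h) q); lra.
Qed.

Lemma tonelli_regular n F q h xq eq K : ucont n F ->
  forall i, (i < n)%nat -> continuity (fun t => tonelli F q h xq eq K t i) /\
    forall t, derivable_pt_lim (fun s => tonelli F q h xq eq (S K) s i) t
      (F (tonelli F q h xq eq K (Rmin (t + h) q)) (Rmin (t + h) q) i + eq i).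
Proof.
  intros HF.
  assert (Hstep : forall K, (forall i, (i < n)%nat -> continuity (fun t => tonelli F q h xq eq K t i)) ->
    forall i, (i < n)%nat -> forall t, derivable_pt_lim (fun s => tonelli F q h xq eq (S K) s i) t
      (F (tonelli F q h xq eq K (Rmin (t + h) q)) (Rmin (t + h) q) i + eq i)).
  { intros K' Hc i Hi t. simpl.
    rewrite <- (Rplus_0_l (F _ _ i + eq i)).
    apply (derivable_pt_lim_plus (fun _ => xq i)); [apply derivable_pt_lim_const|].
    apply (RInt_derivable (fun s =>
      F (tonelli F q h xq eq K' (Rmin (s + h) q)) (Rmin (s + h) q) i + eq i)).
    apply (continuity_plus (fun s =>
      F (tonelli F q h xq eq K' (Rmin (s + h) q)) (Rmin (s + h) q) i) (fun _ => eq i)).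
    - apply (ucont_comp n F (tonelli F q h xq eq K') (fun s => Rmin (s + h) q)); auto.
      apply continuity_Rmin_shift.
    - apply continuity_const. intros ? ?; reflexivity. }
  assert (Hc : forall K i, (i < n)%nat -> continuity (fun t => tonelli F q h xq eq K t i)).
  { induction K0 as [|K' IH]; intros i Hi.
    - apply continuity_const. intros ? ?; reflexivity.
    - intros t. apply derivable_continuous_pt. eexists. apply (Hstep K'); auto. }
  intros i Hi. split; [auto|]. apply Hstep; auto.
Qed.

Lemma tonelli_end F q h xq eq K i : tonelli F q h xq eq K q i = xq i.
Proof.
  destruct K as [|K]; [reflexivity|]. cbn [tonelli]. rewrite RInt_point.
  unfold zero; simpl. ring.
Qed.

(** The value at [t] involves the previous iterate only at times [Rmin (r + h) q] with [r] between
    [t] and [q], so each iteration settles one more stretch of length [h] back from [q]. *)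
Lemma tonelli_stable n F q h xq eq K : ucont n F -> 0 <= h ->
  forall t i, q - INR K * h <= t <= q -> (i < n)%nat ->
    tonelli F q h xq eq (S K) t i = tonelli F q h xq eq K t i.
Proof.
  intros HF Hh. induction K as [|K IH]; intros t i Ht Hi.
  - simpl INR in Ht. replace t with q by lra. now rewrite !tonelli_end.
  - rewrite S_INR in Ht. change (xq i + RInt (fun s =>
      F (tonelli F q h xq eq (S K) (Rmin (s + h) q)) (Rmin (s + h) q) i + eq i) q t
      = xq i + RInt (fun s =>
      F (tonelli F q h xq eq K (Rmin (s + h) q)) (Rmin (s + h) q) i + eq i) q t).
    f_equal. apply RInt_ext. rewrite Rmin_right, Rmax_left by lra. intros s Hs. f_equal.
    apply (ucont_congr n F); auto. intros j Hj. apply IH; auto.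
    split; [|apply Rmin_r]. apply Rmin_glb; [lra|]. pose proof (pos_INR K). nra.
Qed.

Lemma lipschitz_of_derivative (f df : R -> R) B s t :
  (forall r, derivable_pt_lim f r (df r)) -> (forall r, Rabs (df r) <= B) ->
  Rabs (f s - f t) <= B * Rabs (s - t).
Proof.
  intros Hd HB. destruct (MVT_gen f t s df) as (c & _ & E).
  - intros r _. apply is_derive_Reals, Hd.
  - intros r _. apply derivable_continuous_pt. eexists. apply Hd.
  - rewrite E, Rabs_mult. apply Rmult_le_compat_r; [apply Rabs_pos|apply HB].
Qed.

(** The defect is [eq] plus [F] at the advanced point minus [F] at the current one. The cap at [q]
    makes the advance vanish there, so the defect ends exactly at [eq] and consecutive pieces can be
    glued continuously. *)
Lemma approximate_solution n F B p q xq eq eps :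
  ucont n F -> (forall xi t i, (i < n)%nat -> Rabs (F xi t i) <= B) ->
  p <= q -> 0 < eps ->
  exists x e : R -> nat -> R,
    (forall i, (i < n)%nat -> continuity (fun t => x t i) /\ continuity (fun t => e t i) /\
       x q i = xq i /\ e q i = eq i) /\
    (forall t i, (i < n)%nat -> derivable_pt_lim (fun s => x s i) t (F (x t) t i + e t i)) /\
    (forall t i, p <= t <= q -> (i < n)%nat -> Rabs (e t i - eq i) <= eps).
Proof.
  intros HF HB Hpq He.
  destruct (HF eps He) as (d & Hd & Huc).
  destruct (finite_bound n (fun i E => Rabs (eq i) <= E)) as [E HE].
  { intros; lra. } { intros i _. exists (Rabs (eq i)). lra. }
  (* [C] bounds the speed of the iterates: during the advance [h] the state moves by at most
     [d / 2], and [C >= 1] gives [h < d]. *)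
  set (C := Rmax 0 B + Rmax 0 E + 1).
  pose proof (Rmax_l 0 B). pose proof (Rmax_r 0 B).
  pose proof (Rmax_l 0 E). pose proof (Rmax_r 0 E).
  assert (HC : 1 <= C) by (unfold C; lra).
  set (h := d / (2 * C)). assert (Hh : 0 < h) by (apply Rdiv_lt_0_compat; lra).
  assert (HCh : C * h = d / 2) by (unfold h; field; lra).
  assert (Hhd : h < d) by nra.
  (* [K] stretches of length [h] cover [[p, q]], so the iterates [K] and [S K] coincide there. *)
  destruct (INR_unbounded ((q - p) / h)) as [K HK].
  assert (HKh : q - INR K * h <= p).
  { apply (Rmult_lt_compat_r h) in HK; [|exact Hh].
    unfold Rdiv in HK. rewrite Rmult_assoc, Rinv_l in HK; lra. }
  set (X := tonelli F q h xq eq).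
  exists (X (S K)), (fun t i => F (X K (Rmin (t + h) q)) (Rmin (t + h) q) i + eq i - F (X (S K) t) t i).
  split; [|split].
  - intros i Hi.
    assert (Hc : forall K j, (j < n)%nat -> continuity (fun t => X K t j))
      by (intros K' j Hj; apply (tonelli_regular n F q h xq eq K' HF j Hj)).
    split; [auto|split; [|split]].
    + apply (continuity_minus (fun t => F (X K (Rmin (t + h) q)) (Rmin (t + h) q) i + eq i)
        (fun t => F (X (S K) t) t i)).
      * apply (continuity_plus (fun t => F (X K (Rmin (t + h) q)) (Rmin (t + h) q) i) (fun _ => eq i)).
        -- apply (ucont_comp n F (X K) (fun s => Rmin (s + h) q)); auto.
           apply continuity_Rmin_shift.
        -- apply continuity_const. intros ? ?; reflexivity.
      * apply (ucont_comp n F (X (S K)) (fun s => s)); auto.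
        apply derivable_continuous, derivable_id.
    + apply tonelli_end.
    + rewrite Rmin_right by lra.
      rewrite (ucont_congr n F (X (S K) q) (X K q)); auto; [ring|].
      intros j _. unfold X. now rewrite !tonelli_end.
  - intros t i Hi.
    replace (F (X (S K) t) t i + _)
      with (F (X K (Rmin (t + h) q)) (Rmin (t + h) q) i + eq i) by ring.
    apply (tonelli_regular n F q h xq eq K HF i Hi).
  - intros t i Ht Hi. set (m := Rmin (t + h) q).
    assert (Hm : t <= m <= q) by (unfold m, Rmin; destruct (Rle_dec (t + h) q); lra).
    assert (Hmh : m <= t + h) by apply Rmin_l.
    replace (F (X K m) m i + eq i - F (X (S K) t) t i - eq i)
      with (F (X K m) m i - F (X (S K) t) t i) by ring.
    rewrite <- (ucont_congr n F (X K m) (X (S K) m)); auto.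
    + left. apply Huc; auto.
      * intros j Hj. eapply Rle_lt_trans.
        { apply (lipschitz_of_derivative (fun s => X (S K) s j) _ C m t
            (proj2 (tonelli_regular n F q h xq eq K HF j Hj))).
          intros r. eapply Rle_trans; [apply Rabs_triang|].
          specialize (HB (tonelli F q h xq eq K (Rmin (r + h) q)) (Rmin (r + h) q) j Hj).
          specialize (HE j Hj). unfold C. lra. }
        rewrite Rabs_pos_eq by lra.
        apply Rle_lt_trans with (C * h); [apply Rmult_le_compat_l; lra|lra].
      * rewrite Rabs_pos_eq by lra. lra.
    + intros j Hj. apply (tonelli_stable n); auto; lra.
Qed.

(** * Stability implies joint connectivity *)

Lemma jcont_congr n h xi xi' t : jcont n h ->
  (forall j, (j < n)%nat -> xi' j = xi j) -> h xi' t = h xi t.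
Proof.
  intros Hh E. apply cond_eq. intros eps He.
  destruct (Hh xi t eps He) as (d & Hd & H). apply H.
  - intros j Hj. rewrite E, Rminus_diag, Rabs_R0; auto.
  - rewrite Rminus_diag, Rabs_R0; auto.
Qed.

(** Pieces are built backward: the state and the defect of the latest piece at its left end become
    terminal data for the earlier ones. Deviations of the defect add up to one [eps] per
    interval. *)
Lemma concatenated_approximation n (s : nat -> R) (sigma : R -> digraph)
  (F : digraph -> (nat -> R) -> R -> nat -> R) eps :
  s O = 0 -> (forall m, s m < s (S m)) ->
  (forall m t, s m <= t < s (S m) -> sigma t = sigma (s m)) ->
  (forall G, ucont n (F G)) ->
  (forall G, exists B, forall xi t i, (i < n)%nat -> Rabs (F G xi t i) <= B) ->
  0 < eps ->
  forall m xq eq, exists x e : R -> nat -> R,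
    (forall i, (i < n)%nat -> continuity (fun t => x t i) /\ continuity (fun t => e t i) /\
       x (s m) i = xq i /\ e (s m) i = eq i) /\
    (forall t i, 0 < t < s m -> (forall m', t <> s m') -> (i < n)%nat ->
       derivable_pt_lim (fun r => x r i) t (F (sigma t) (x t) t i + e t i)) /\
    (forall t i, 0 <= t <= s m -> (i < n)%nat -> Rabs (e t i - eq i) <= INR m * eps).
Proof.
  intros Hs0 Hs Hsig HF HB He. induction m as [|m IH]; intros xq eq.
  - exists (fun _ => xq), (fun _ => eq). split; [|split].
    + intros i Hi. repeat split; apply continuity_const; intros ? ?; reflexivity.
    + intros t i Ht. lra.
    + intros t i _ _. rewrite Rminus_diag, Rabs_R0. simpl. lra.
  - destruct (HB (sigma (s m))) as [B HBm].
    destruct (approximate_solution n (F (sigma (s m))) B (s m) (s (S m)) xq eq eps)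
      as (x2 & e2 & H1 & H2 & H3); auto; [left; apply Hs|].
    destruct (IH (x2 (s m)) (e2 (s m))) as (x1 & e1 & G1 & G2 & G3).
    specialize (Hs m).
    exists (fun t => if Rle_dec t (s m) then x1 t else x2 t),
           (fun t => if Rle_dec t (s m) then e1 t else e2 t).
    assert (Ex : forall (f g : R -> nat -> R) i t,
      (if Rle_dec t (s m) then f t else g t) i = if Rle_dec t (s m) then f t i else g t i)
      by (intros; destruct (Rle_dec t (s m)); reflexivity).
    split; [|split].
    + intros i Hi. destruct (H1 i Hi) as (A1 & A2 & A3 & A4).
      destruct (G1 i Hi) as (B1 & B2 & B3 & B4). repeat split.
      * intros t. apply (continuity_pt_ext (fun t => if Rle_dec t (s m) then x1 t i else x2 t i));
          [intros; symmetry; apply Ex|]. apply continuity_glue; auto.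
      * intros t. apply (continuity_pt_ext (fun t => if Rle_dec t (s m) then e1 t i else e2 t i));
          [intros; symmetry; apply Ex|]. apply continuity_glue; auto.
      * rewrite Ex. destruct (Rle_dec (s (S m)) (s m)); [lra|exact A3].
      * rewrite Ex. destruct (Rle_dec (s (S m)) (s m)); [lra|exact A4].
    + intros t i Ht Hne Hi. pose proof (Hne m) as Hnm.
      destruct (Rle_dec t (s m)) as [Hle|Hle].
      * apply (derivable_pt_lim_local (fun r => x1 r i) _ t (s m - t)); [lra| |].
        -- intros r Hr. apply Rabs_def2 in Hr. destruct (Rle_dec r (s m)); [reflexivity|lra].
        -- apply G2; auto. lra.
      * apply (derivable_pt_lim_local (fun r => x2 r i) _ t (t - s m)); [lra| |].
        -- intros r Hr. apply Rabs_def2 in Hr. destruct (Rle_dec r (s m)); [lra|reflexivity].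
        -- rewrite (Hsig m t) by lra. auto.
    + intros t i Ht Hi. rewrite S_INR. rewrite Ex.
      assert (0 <= INR m * eps) by (apply Rmult_le_pos; [apply pos_INR|lra]).
      destruct (Rle_dec t (s m)).
      * specialize (G3 t i ltac:(lra) Hi). specialize (H3 (s m) i ltac:(lra) Hi).
        replace (e1 t i - eq i) with ((e1 t i - e2 (s m) i) + (e2 (s m) i - eq i)) by ring.
        eapply Rle_trans; [apply Rabs_triang|]. lra.
      * specialize (H3 t i ltac:(lra) Hi). lra.
Qed.

(** [V t * exp (C * t)] is nondecreasing. In [C], the term [2 * K * INR n] covers the field through
    Cauchy-Schwarz; the 1 covers [2 * x * e >= - (x^2 + eps^2)], the reason why [V] includes
    [INR n * eps^2]. *)
Lemma backward_gronwall n (x f e : R -> nat -> R) K L p q eps :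
  0 <= K -> p <= q ->
  (forall i, (i < n)%nat -> continuity (fun t => x t i)) ->
  (forall t i, p < t < q -> ~ In t L -> (i < n)%nat ->
     derivable_pt_lim (fun r => x r i) t (f t i + e t i) /\
     Rabs (f t i) <= K * sumR n (fun j => Rabs (x t j)) /\ Rabs (e t i) <= eps) ->
  sumR n (fun i => x p i ^ 2) <=
    (sumR n (fun i => x q i ^ 2) + INR n * eps ^ 2) * exp ((2 * K * INR n + 1) * (q - p)).
Proof.
  intros HK Hpq Hc Hd.
  set (C := 2 * K * INR n + 1).
  set (V := fun t => sumR n (fun i => x t i ^ 2) + INR n * eps ^ 2).
  pose proof (nonincreasing_except L (fun t => - (V t * exp (C * t))) p q Hpq) as H.
  cbv beta in H.
  assert (Hm : - (V q * exp (C * q)) <= - (V p * exp (C * p))).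
  { apply H; clear H.
    - intros t _. apply (continuity_pt_opp (fun t => V t * exp (C * t))).
      apply (continuity_pt_mult V (fun t => exp (C * t))).
      + apply (continuity_pt_plus (fun t => sumR n (fun i => x t i ^ 2)) (fun _ => INR n * eps ^ 2)).
        * apply (continuity_pt_sumR n (fun i t => x t i ^ 2)). intros i Hi.
          apply (continuity_pt_ext (fun t => x t i * x t i)); [intros; simpl; ring|].
          apply continuity_pt_mult; apply Hc, Hi.
        * apply continuity_pt_const. intros ? ?; reflexivity.
      + apply derivable_continuous_pt. eexists. apply derivable_pt_lim_exp_scal.
    - intros t Ht HL.
      set (dV := sumR n (fun i => 2 * x t i * (f t i + e t i))).
      exists (- ((dV + 0) * exp (C * t) + V t * (C * exp (C * t)))). split.
      + apply (derivable_pt_lim_opp (fun t => V t * exp (C * t))).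
        apply (derivable_pt_lim_mult V (fun t => exp (C * t))); [|apply derivable_pt_lim_exp_scal].
        apply (derivable_pt_lim_plus (fun t => sumR n (fun i => x t i ^ 2)) (fun _ => INR n * eps ^ 2));
          [|apply derivable_pt_lim_const].
        apply (derivable_pt_lim_sumR n (fun i t => x t i ^ 2)). intros i Hi.
        destruct (Hd t i Ht HL Hi) as (H1 & _).
        apply (derivable_pt_lim_comp (fun r => x r i) (fun r => r ^ 2)); [exact H1|].
        apply is_derive_Reals. auto_derive; auto. ring.
      + set (W := sumR n (fun j => Rabs (x t j))).
        assert (HW : 0 <= W) by (apply sumR_nonneg; intros; apply Rabs_pos).
        set (Q := sumR n (fun i => x t i ^ 2)).
        assert (HWQ : W ^ 2 <= INR n * Q).
        { unfold W. eapply Rle_trans; [apply sumR_pow2_le|].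
          right. f_equal. apply sumR_ext. intros. apply pow2_abs. }
        assert (HdV : - (2 * K * W * W) - Q - INR n * eps ^ 2 <= dV).
        { assert (Hs : sumR n (fun i => 2 * (K * W) * Rabs (x t i) + (x t i ^ 2 + eps ^ 2) + 2 * x t i * (f t i + e t i))
            = 2 * K * W * W + (Q + INR n * eps ^ 2) + dV).
          { rewrite !sumR_plus, sumR_const, sumR_scal. fold W. fold dV. fold Q. ring. }
          assert (0 <= sumR n (fun i => 2 * (K * W) * Rabs (x t i) + (x t i ^ 2 + eps ^ 2) + 2 * x t i * (f t i + e t i))); [|lra].
          apply sumR_nonneg. intros i Hi. destruct (Hd t i Ht HL Hi) as (_ & H2 & H3). fold W in H2.
          assert (A1 : - (K * W * Rabs (x t i)) <= x t i * f t i).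
          { assert (Rabs (x t i * f t i) <= K * W * Rabs (x t i)).
            { rewrite Rabs_mult, Rmult_comm. apply Rmult_le_compat_r; [apply Rabs_pos|exact H2]. }
            apply Rabs_le_between in H. lra. }
          assert (A2 : - (x t i ^ 2 + eps ^ 2) <= 2 * (x t i * e t i)).
          { apply Rabs_le_between in H3. pose proof (pow2_ge_0 (x t i + e t i)).
            assert (e t i ^ 2 <= eps ^ 2) by nra. nra. }
          lra. }
        pose proof (exp_pos (C * t)) as He.
        assert (Hn : 0 <= INR n * eps ^ 2) by (apply Rmult_le_pos; [apply pos_INR|apply pow2_ge_0]).
        assert (HKn : 0 <= 2 * K * INR n) by (apply Rmult_le_pos; [lra|apply pos_INR]).
        assert (HKW : 2 * K * W * W <= 2 * K * INR n * Q) by nra.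
        assert (Hfin : 0 <= dV + C * V t).
        { unfold V. fold Q. unfold C.
          assert (0 <= 2 * K * INR n * (INR n * eps ^ 2)) by (apply Rmult_le_pos; lra). lra. }
        assert (0 <= (dV + C * V t) * exp (C * t)) by (apply Rmult_le_pos; lra). lra. }
  apply Rmult_le_reg_r with (exp (C * p)); [apply exp_pos|].
  rewrite Rmult_assoc, <- exp_plus. replace (C * (q - p) + C * p) with (C * q) by ring.
  fold (V q).
  apply Rle_trans with (V p * exp (C * p)); [|lra].
  apply Rmult_le_compat_r; [left; apply exp_pos|]. unfold V.
  assert (0 <= INR n * eps ^ 2) by (apply Rmult_le_pos; [apply pos_INR|apply pow2_ge_0]). lra.
Qed.

(** * Motion on the first coordinate axis with leaders at the origin *)

Definition on_first_axis (xi : nat -> R) : Vecs :=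
  fun i l => match l with O => xi i | S _ => 0 end.

Definition origin : Vecs := fun _ _ => 0.

(** The undisturbed scalar field for one frozen graph: each dwell interval then has a field
    continuous in state and time. *)
Definition axis_rhs n k a b (G : digraph) (i : nat) (xi : nat -> R) (t : R) : R :=
  follower_rhs n k (fun _ => G) a b (fun _ _ _ => 0) (on_first_axis xi) origin t i 0.

Lemma jcont_weight n k d f : weight_continuous n k d f ->
  jcont n (fun xi t => f (on_first_axis xi) origin t).
Proof.
  intros Hf xi t eps He.
  destruct (Hf (on_first_axis xi) origin t eps He) as (dl & Hd & H).
  exists dl. split; [exact Hd|]. intros xi' t' Hx Ht. apply H; auto.
  - intros i [|l] Hi _; simpl; [auto|]. now rewrite Rminus_diag, Rabs_R0.
  - intros. unfold origin. now rewrite Rminus_diag, Rabs_R0.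
Qed.

Lemma jcont_axis_rhs n k d a b G i : (i < n)%nat ->
  (forall i j, (i < n)%nat -> (j < n)%nat -> weight_continuous n k d (a i j)) ->
  (forall i j, (i < n)%nat -> (j < k)%nat -> weight_continuous n k d (b i j)) ->
  jcont n (axis_rhs n k a b G i).
Proof.
  intros Hi Ha Hb. unfold axis_rhs, follower_rhs.
  apply jcont_plus; [apply jcont_plus|apply jcont_const].
  - apply (jcont_sumR n n (fun j xi t => if G (FN j) (FN i) then
      a i j (on_first_axis xi) origin t * (xi j - xi i) else 0)).
    intros j Hj. destruct (G (FN j) (FN i)); [|apply jcont_const].
    apply (jcont_mult n (fun xi t => a i j (on_first_axis xi) origin t)).
    + apply (jcont_weight n k d); auto.
    + apply (jcont_plus n (fun xi _ => xi j) (fun xi _ => - xi i)).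
      * apply jcont_coord, Hj.
      * intros xi t eps He. exists eps. split; [exact He|]. intros xi' t' Hx _.
        replace (- xi' i - - xi i) with (- (xi' i - xi i)) by ring. rewrite Rabs_Ropp. auto.
  - apply (jcont_sumR n k (fun j xi t => if G (LN j) (FN i) then
      b i j (on_first_axis xi) origin t * (0 - xi i) else 0)).
    intros j Hj. destruct (G (LN j) (FN i)); [|apply jcont_const].
    apply (jcont_mult n (fun xi t => b i j (on_first_axis xi) origin t)).
    + apply (jcont_weight n k d); auto.
    + intros xi t eps He. exists eps. split; [exact He|]. intros xi' t' Hx _.
      replace (0 - xi' i - (0 - xi i)) with (- (xi' i - xi i)) by ring. rewrite Rabs_Ropp. auto.
Qed.

(** The field vanishes at the origin, whence linear growth. Leader weights are bounded above only
    through continuity on the compact box; the resulting constant serves all graphs. *)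
Lemma axis_rhs_growth n k d a b a_lo a_hi b_lo t0 :
  0 < a_lo -> a_lo <= a_hi -> 0 < b_lo ->
  (forall i j x y t, (i < n)%nat -> (j < n)%nat -> a_lo <= a i j x y t <= a_hi) ->
  (forall i j x y t, (i < n)%nat -> (j < k)%nat -> b_lo <= b i j x y t) ->
  (forall i j, (i < n)%nat -> (j < k)%nat -> weight_continuous n k d (b i j)) ->
  exists K, 0 <= K /\ forall G i xi t, (i < n)%nat -> box n t0 xi t ->
    Rabs (axis_rhs n k a b G i xi t) <= K * sumR n (fun j => Rabs (xi j)).
Proof.
  intros Ha Hah Hb Hab Hbb Hbc.
  destruct (finite_bound n (fun i B => forall j, (j < k)%nat -> forall xi t, box n t0 xi t ->
    Rabs (b i j (on_first_axis xi) origin t) <= B)) as [B HB].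
  { intros i B B' HBB H j Hj xi t Hx. specialize (H j Hj xi t Hx). lra. }
  { intros i Hi. apply (finite_bound k (fun j B => forall xi t, box n t0 xi t ->
      Rabs (b i j (on_first_axis xi) origin t) <= B)).
    - intros j B B' HBB H xi t Hx. specialize (H xi t Hx). lra.
    - intros j Hj. apply (jcont_bounded n t0 (fun xi t => b i j (on_first_axis xi) origin t)).
      apply (jcont_weight n k d). auto. }
  set (B' := Rmax 0 B).
  assert (HB'0 : 0 <= B') by apply Rmax_l.
  assert (HBB' : B <= B') by apply Rmax_r.
  pose proof (pos_INR n) as Hn. pose proof (pos_INR k) as Hk.
  assert (Hna : 0 <= INR n * a_hi) by (apply Rmult_le_pos; lra).
  assert (HkB : 0 <= INR k * B') by (apply Rmult_le_pos; lra).
  exists (a_hi + INR n * a_hi + INR k * B'). split; [lra|].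
  intros G i xi t Hi Hbox. set (W := sumR n (fun j => Rabs (xi j))).
  assert (HiW : Rabs (xi i) <= W)
    by (apply (sumR_ge_term n (fun j => Rabs (xi j))); [intros; apply Rabs_pos|exact Hi]).
  pose proof (Rabs_pos (xi i)) as Hi0.
  unfold axis_rhs, follower_rhs. rewrite Rplus_0_r.
  eapply Rle_trans; [apply Rabs_triang|].
  assert (H1 : Rabs (sumR n (fun j => if G (FN j) (FN i) then
      a i j (on_first_axis xi) origin t * (on_first_axis xi j O - on_first_axis xi i O) else 0))
      <= a_hi * W + INR n * (a_hi * W)).
  { eapply Rle_trans; [apply sumR_abs|]. unfold W at 1.
    rewrite <- sumR_scal, <- sumR_const, <- sumR_plus. apply sumR_le. intros j Hj. simpl.
    pose proof (Rabs_pos (xi j)).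
    assert (0 <= a_hi * Rabs (xi j)) by (apply Rmult_le_pos; lra).
    assert (a_hi * Rabs (xi i) <= a_hi * W) by (apply Rmult_le_compat_l; lra).
    destruct (G (FN j) (FN i)).
    - specialize (Hab i j (on_first_axis xi) origin t Hi Hj).
      rewrite Rabs_mult, (Rabs_pos_eq (a _ _ _ _ _)) by lra.
      apply Rle_trans with (a_hi * (Rabs (xi j) + Rabs (xi i))); [|lra].
      apply Rmult_le_compat; [lra|apply Rabs_pos|lra|].
      unfold Rminus. eapply Rle_trans; [apply Rabs_triang|]. rewrite Rabs_Ropp. lra.
    - rewrite Rabs_R0. assert (0 <= a_hi * Rabs (xi i)) by (apply Rmult_le_pos; lra). lra. }
  assert (H2 : Rabs (sumR k (fun j => if G (LN j) (FN i) then
      b i j (on_first_axis xi) origin t * (origin j O - on_first_axis xi i O) else 0))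
      <= INR k * (B' * W)).
  { eapply Rle_trans; [apply sumR_abs|].
    rewrite <- sumR_const. apply sumR_le. intros j Hj. simpl.
    destruct (G (LN j) (FN i)).
    - rewrite Rabs_mult. specialize (HB i Hi j Hj xi t Hbox).
      apply Rmult_le_compat; try apply Rabs_pos; [lra|].
      unfold origin. rewrite Rminus_0_l, Rabs_Ropp. exact HiW.
    - rewrite Rabs_R0. apply Rmult_le_pos; lra. }
  lra.
Qed.

Lemma follower_rhs_off_axis n k sigma a b w xi t i l :
  follower_rhs n k sigma a b w (on_first_axis xi) origin t i (S l) = w i t (S l).
Proof.
  unfold follower_rhs. rewrite !sumR_zero; [ring| |].
  - intros j _. destruct (sigma t (LN j) (FN i)); [unfold origin; simpl; ring|reflexivity].
  - intros j _. destruct (sigma t (FN j) (FN i)); [simpl; ring|reflexivity].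
Qed.

Lemma follower_rhs_on_axis n k sigma a b w xi t i :
  follower_rhs n k sigma a b w (on_first_axis xi) origin t i O
  = axis_rhs n k a b (sigma t) i xi t + w i t O.
Proof. unfold axis_rhs, follower_rhs. ring. Qed.

Lemma axis_rhs_equilibrium n k a b G xi t i :
  (forall j, (j < n)%nat -> G (FN j) (FN i) = true -> xi j = xi i) ->
  (forall j, (j < k)%nat -> G (LN j) (FN i) = true -> xi i = 0) ->
  axis_rhs n k a b G i xi t = 0.
Proof.
  intros H1 H2. unfold axis_rhs, follower_rhs. rewrite !sumR_zero; [ring| |].
  - intros j Hj. destruct (G (LN j) (FN i)) eqn:E; [|reflexivity].
    unfold origin, on_first_axis. rewrite (H2 j); auto. ring.
  - intros j Hj. destruct (G (FN j) (FN i)) eqn:E; [|reflexivity].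
    unfold on_first_axis. rewrite (H1 j); auto. ring.
Qed.

Lemma set_dist_on_axis n k d xi i : (1 <= k)%nat -> (1 <= d)%nat -> (i < n)%nat ->
  xi i <= set_dist n k d (on_first_axis xi) origin.
Proof.
  intros Hk Hd Hi.
  eapply Rle_trans; [|apply (maxR_ge n (fun i => hull_dist k d origin (on_first_axis xi i))), Hi].
  apply (hull_dist_spec k d origin _ Hk). intros p (lam & _ & _ & Hp).
  eapply Rle_trans; [apply Rle_abs|]. rewrite <- sqrt_Rsqr_abs. apply sqrt_le_1_alt.
  assert (Hp0 : p O = 0).
  { rewrite (Hp O) by lia. apply sumR_zero. intros; unfold origin; ring. }
  eapply Rle_trans; [|apply (sumR_ge_term d (fun l => (on_first_axis xi i l - p l) ^ 2) O);
    [intros; apply pow2_ge_0|lia]].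
  simpl. rewrite Hp0. unfold Rsqr. lra.
Qed.

Definition axis_input (e : R -> nat -> R) : nat -> R -> nat -> R :=
  fun i t l => match l with O => e t i | S _ => 0 end.

Definition no_input : nat -> Vecs -> R -> nat -> R := fun _ _ _ _ => 0.

Lemma znorm_axis n k d e y t : (1 <= d)%nat ->
  znorm n k d no_input (axis_input e) y t = sqrt (sumR n (fun i => e t i ^ 2)).
Proof.
  intros Hd. unfold znorm. f_equal.
  rewrite sumR_zero, Rplus_0_l.
  - apply sumR_ext. intros i _.
    rewrite (sumR_single d _ O); [reflexivity|lia|].
    intros [|l] _ Hl; [lia|simpl; ring].
  - intros j _. apply sumR_zero. intros; unfold no_input; ring.
Qed.

Lemma admissible_no_input k d j : admissible_u k d (no_input j).
Proof.
  unfold no_input. split.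
  - intros t l _ _ y eps He. exists 1. split; [lra|]. intros. now rewrite Rminus_diag, Rabs_R0.
  - exists INR. split; [reflexivity|split; [|split]].
    + intros m. rewrite S_INR. lra.
    + apply INR_unbounded.
    + intros m. exists (fun _ _ _ => 0). split; [reflexivity|].
      intros l _ y t eps _ He. exists 1. split; [lra|]. intros. now rewrite Rminus_diag, Rabs_R0.
Qed.

Lemma continuity_cont_nonneg f : continuity f -> cont_nonneg f.
Proof.
  intros H t eps _ He. destruct (proj1 (continuity_pt_eps f t) (H t) eps He) as (dl & Hd & Hs).
  exists dl. auto.
Qed.

Lemma dwell_partition_unbounded (s : nat -> R) tau : 0 < tau -> s O = 0 ->
  (forall m, s m + tau <= s (S m)) -> (forall m, 0 <= s m) /\ forall T, exists m, T <= s m.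
Proof.
  intros Htau Hs0 Hs.
  assert (H : forall m, INR m * tau <= s m).
  { induction m as [|m IH]; [simpl; lra|]. rewrite S_INR. specialize (Hs m). lra. }
  split.
  - intros m. specialize (H m). pose proof (pos_INR m). nra.
  - intros T. destruct (INR_unbounded (T / tau)) as [m Hm]. exists m.
    apply (Rmult_lt_compat_r tau) in Hm; [|exact Htau].
    unfold Rdiv in Hm. rewrite Rmult_assoc, Rinv_l in Hm by lra. specialize (H m). lra.
Qed.

(* Integrating the approximate equation backward from a prescribed state. *)
Lemma solution_to_equilibrium n k d a b a_lo a_hi b_lo sigma s m0 (c : nat -> R) :
  (1 <= d)%nat ->
  (forall i j, (i < n)%nat -> (j < n)%nat -> weight_continuous n k d (a i j)) ->
  (forall i j, (i < n)%nat -> (j < k)%nat -> weight_continuous n k d (b i j)) ->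
  0 < a_lo -> a_lo <= a_hi -> 0 < b_lo ->
  (forall i j x y t, (i < n)%nat -> (j < n)%nat -> a_lo <= a i j x y t <= a_hi) ->
  (forall i j x y t, (i < n)%nat -> (j < k)%nat -> b_lo <= b i j x y t) ->
  s O = 0 -> (forall m, s m < s (S m)) ->
  (forall m t, s m <= t < s (S m) -> sigma t = sigma (s m)) ->
  (forall i t r, (i < n)%nat -> s m0 <= t -> axis_rhs n k a b (sigma t) i (fun j => r * c j) t = 0) ->
  (forall i, (i < n)%nat -> 0 <= c i <= 1) ->
  exists r, 0 < r /\ forall eps, 0 < eps <= r -> exists (xi e : R -> nat -> R),
    admissible_w n d (axis_input e) /\
    is_solution n k d sigma a b no_input (axis_input e) (fun t => on_first_axis (xi t)) (fun _ => origin) /\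
    (forall t i, s m0 <= t -> (i < n)%nat -> xi t i = r * c i /\ e t i = 0) /\
    (forall t i, 0 <= t <= s m0 -> (i < n)%nat -> Rabs (e t i) <= eps).
Proof.
  intros Hd1 Hac Hbc Ha Hah Hb Hab Hbb Hs0 Hs Hsig Heq Hc.
  set (t0 := s m0).
  assert (Hmono : forall m m', (m < m')%nat -> s m < s m').
  { intros m m' H. induction H as [|m' _ IH]; [apply Hs|]. specialize (Hs m'). lra. }
  assert (Ht0 : 0 <= t0).
  { unfold t0. rewrite <- Hs0. destruct m0 as [|m]; [lra|]. left. apply Hmono. lia. }
  destruct (axis_rhs_growth n k d a b a_lo a_hi b_lo t0) as (K & HK & Hgrow); auto.
  set (C := 2 * K * INR n + 1).
  assert (HC : 0 <= C).
  { unfold C. assert (0 <= 2 * K * INR n) by (apply Rmult_le_pos; [lra|apply pos_INR]). lra. }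
  pose proof (pos_INR n) as Hn.
  (* Chosen so that [2 * (INR n + 1) * r * exp (C * t0) = 1]. As [r <= 1], [c i <= 1] and
     [eps <= r], the energy at [t0] is at most [2 * INR n * r], and backward Gronwall keeps it at
     most 1 on [[0, t0]]. *)
  set (r := exp (- (C * t0)) / (2 * (INR n + 1))).
  assert (Hr : 0 < r) by (apply Rdiv_lt_0_compat; [apply exp_pos|lra]).
  assert (Hexp : exp (C * t0) * exp (- (C * t0)) = 1).
  { rewrite <- exp_plus. replace (C * t0 + - (C * t0)) with 0 by ring. apply exp_0. }
  assert (Hexp1 : 1 <= exp (C * t0)).
  { assert (0 <= C * t0) by (apply Rmult_le_pos; lra).
    pose proof (exp_ineq1_le (C * t0)). lra. }
  assert (Hre : 2 * (INR n + 1) * r * exp (C * t0) = 1).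
  { transitivity (exp (C * t0) * exp (- (C * t0))); [unfold r; field; lra|exact Hexp]. }
  assert (Hr2 : r <= 2 * (INR n + 1) * r) by nra.
  assert (Hr1 : r <= 1).
  { assert (2 * (INR n + 1) * r * 1 <= 2 * (INR n + 1) * r * exp (C * t0))
      by (apply Rmult_le_compat_l; lra). lra. }
  exists r. split; [exact Hr|]. intros eps [He Her].
  set (F := fun (G : digraph) (xi : nat -> R) t i =>
    axis_rhs n k a b G i (fun j => clamp (-1) 1 (xi j)) (clamp 0 t0 t)).
  assert (Hj : forall G i, (i < n)%nat -> jcont n (axis_rhs n k a b G i))
    by (intros; apply (jcont_axis_rhs n k d); auto).
  assert (Hbox : forall xi t, box n t0 (fun j => clamp (-1) 1 (xi j)) (clamp 0 t0 t)).
  { intros xi t. split; [intros; apply clamp_range; lra|apply clamp_range; lra]. }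
  pose proof (pos_INR m0) as Hm0.
  (* The tolerances of [m0] intervals add up to at most [eps]; adding 1 covers [m0 = 0]. *)
  destruct (concatenated_approximation n s sigma F (eps / (INR m0 + 1))) with
    (m := m0) (xq := fun i => r * c i) (eq := fun _ : nat => 0) as (x1 & e1 & H1 & H2 & H3); auto.
  { intros G. apply (ucont_clamp n t0 (fun i => axis_rhs n k a b G i)); auto. }
  { intros G. destruct (finite_bound n (fun i B => forall xi t, box n t0 xi t ->
      Rabs (axis_rhs n k a b G i xi t) <= B)) as [B HB].
    - intros i B B' HBB H xi t Hx. specialize (H xi t Hx). lra.
    - intros i Hi. apply jcont_bounded; auto.
    - exists B. intros xi t i Hi. apply HB; auto. }
  { apply Rdiv_lt_0_compat; lra. }
  fold t0 in H1, H2, H3.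
  assert (He1 : forall t i, 0 <= t <= t0 -> (i < n)%nat -> Rabs (e1 t i) <= eps).
  { intros t i Ht Hi. specialize (H3 t i Ht Hi). rewrite Rminus_0_r in H3.
    eapply Rle_trans; [exact H3|].
    apply Rmult_le_reg_r with (INR m0 + 1); [lra|].
    replace (INR m0 * (eps / (INR m0 + 1)) * (INR m0 + 1)) with (INR m0 * eps) by (field; lra).
    lra. }
  assert (Hswitch : forall t, t < t0 -> ~ In t (map s (seq 0 (S m0))) -> forall m, t <> s m).
  { intros t Ht HL m E. destruct (Nat.le_gt_cases m m0) as [Hm|Hm].
    - apply HL, in_map_iff. exists m. split; [auto|]. apply in_seq. lia.
    - specialize (Hmono m0 m Hm). unfold t0 in Ht. lra. }
  (* The growth bound holds for the clamped field everywhere, so no prior bound on [x1] is needed;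
     the estimate shows afterwards that clamping was inactive and the equation is the original
     one. *)
  assert (Hx1 : forall t i, 0 <= t <= t0 -> (i < n)%nat -> -1 <= x1 t i <= 1).
  { intros t i Ht Hi.
    assert (HV : sumR n (fun i => x1 t i ^ 2) <= 1).
    { eapply Rle_trans.
      - apply (backward_gronwall n x1 (fun t i => F (sigma t) (x1 t) t i) e1 K
          (map s (seq 0 (S m0))) t t0 eps HK); [lra| |].
        + intros j Hj'. apply (H1 j Hj').
        + intros u j Hu HL Hj'. split; [|split].
          * apply H2; auto; [lra|]. apply Hswitch; [lra|exact HL].
          * eapply Rle_trans; [apply Hgrow; auto|].
            apply Rmult_le_compat_l; [exact HK|]. apply sumR_le. intros; apply clamp_abs.
          * apply He1; auto. lra.
      - fold C. assert (Hq : sumR n (fun i => x1 t0 i ^ 2) <= INR n * r).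
        { rewrite <- sumR_const. apply sumR_le. intros j Hj'.
          destruct (H1 j Hj') as (_ & _ & -> & _). specialize (Hc j Hj').
          assert (r * c j <= r) by nra. assert (0 <= r * c j) by nra. nra. }
        assert (Heps : INR n * eps ^ 2 <= INR n * r) by (apply Rmult_le_compat_l; nra).
        assert (Hmon : exp (C * (t0 - t)) <= exp (C * t0)).
        { assert (Hle : C * (t0 - t) <= C * t0) by (apply Rmult_le_compat_l; lra).
          destruct Hle as [Hlt|Hle]; [left; now apply exp_increasing|rewrite Hle; lra]. }
        apply Rle_trans with (2 * (INR n + 1) * r * exp (C * t0)); [|lra].
        apply Rmult_le_compat; [|left; apply exp_pos|lra|exact Hmon].
        apply Rplus_le_le_0_compat; [apply sumR_nonneg; intros; apply pow2_ge_0|].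
        apply Rmult_le_pos; [exact Hn|apply pow2_ge_0]. }
    assert (x1 t i ^ 2 <= 1).
    { eapply Rle_trans; [|exact HV].
      apply (sumR_ge_term n (fun i => x1 t i ^ 2)); [intros; apply pow2_ge_0|exact Hi]. }
    split; nra. }
  exists (fun t i => if Rle_dec t t0 then x1 t i else r * c i),
         (fun t i => if Rle_dec t t0 then e1 t i else 0).
  (* Continuity at [t0] holds because the terminal defect was prescribed to be 0. *)
  assert (Hec : forall i, (i < n)%nat -> continuity (fun t => if Rle_dec t t0 then e1 t i else 0)).
  { intros i Hi. apply (continuity_glue (fun t => e1 t i) (fun _ => 0)).
    - apply (H1 i Hi).
    - apply continuity_const. intros ? ?; reflexivity.
    - apply (H1 i Hi). }
  assert (Hxc : forall i, (i < n)%nat -> continuity (fun t => if Rle_dec t t0 then x1 t i else r * c i)).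
  { intros i Hi. apply (continuity_glue (fun t => x1 t i) (fun _ => r * c i)).
    - apply (H1 i Hi).
    - apply continuity_const. intros ? ?; reflexivity.
    - apply (H1 i Hi). }
  split; [|split; [|split]].
  - intros i [|l] Hi _; simpl; [apply Hec, Hi|]. apply continuity_const. intros ? ?; reflexivity.
  - split; [|split].
    + intros i [|l] Hi _; simpl.
      * apply continuity_cont_nonneg, Hxc, Hi.
      * apply continuity_cont_nonneg, continuity_const. intros ? ?; reflexivity.
    + intros j l _ _. apply continuity_cont_nonneg, continuity_const. intros ? ?; reflexivity.
    (* After [t0] the state is constant, so only switching times up to and including [t0] are
       exceptional. *)
    + exists (fun t => In t (map s (seq 0 (S m0)))). split.
      { intros T. exists (map s (seq 0 (S m0))). auto. }
      intros t Htpos HL. split.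
      { intros j l _ _. apply derivable_pt_lim_const. }
      intros i [|l] Hi _.
      2: { rewrite follower_rhs_off_axis. apply derivable_pt_lim_const. }
      rewrite follower_rhs_on_axis. simpl axis_input.
      assert (Hne : t <> t0).
      { intros ->. apply HL, in_map_iff. exists m0. split; [reflexivity|]. apply in_seq. lia. }
      destruct (Rle_dec t t0) as [Hle|Hgt].
      * apply (derivable_pt_lim_local (fun u => x1 u i) _ t (t0 - t)); [lra| |].
        { intros u Hu. apply Rabs_def2 in Hu. simpl. destruct (Rle_dec u t0); [reflexivity|lra]. }
        replace (axis_rhs n k a b (sigma t) i (fun i0 => x1 t i0) t)
          with (F (sigma t) (x1 t) t i).
        { apply H2; auto; [lra|]. apply Hswitch; [lra|exact HL]. }
        unfold F. rewrite (clamp_id 0 t0 t) by lra.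
        apply (jcont_congr n (axis_rhs n k a b (sigma t) i)); auto.
        intros j Hj'. apply clamp_id. apply Hx1; auto. lra.
      * rewrite Heq; auto; [|unfold t0 in *; lra]. rewrite Rplus_0_r.
        apply (derivable_pt_lim_local (fun _ => r * c i) _ t (t - t0)); [lra| |].
        { intros u Hu. apply Rabs_def2 in Hu. simpl. destruct (Rle_dec u t0); [lra|reflexivity]. }
        apply derivable_pt_lim_const.
  - intros t i Ht Hi. fold t0 in Ht. destruct (H1 i Hi) as (_ & _ & E1 & E2).
    destruct (Rle_dec t t0).
    + replace t with t0 by lra. auto.
    + auto.
  - intros t i Ht Hi. fold t0 in Ht. destruct (Rle_dec t t0); [auto|lra].
Qed.

Lemma integral_of_vanishing_tail (g : R -> R) t0 t B : 0 <= t0 <= t -> continuity g ->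
  (forall s, 0 <= s <= t0 -> g s <= B) -> (forall s, t0 <= s -> g s = 0) ->
  RInt g 0 t <= B * t0.
Proof.
  intros Ht Hg HB H0.
  assert (Hex : forall p q, ex_RInt g p q).
  { intros p q. apply (ex_RInt_continuous g p q). intros z _. apply continuity_pt_filterlim, Hg. }
  rewrite <- (RInt_Chasles g 0 t0 t) by apply Hex.
  rewrite (RInt_ext g (fun _ => 0) t0 t).
  - rewrite (RInt_const t0 t 0). unfold plus, scal; simpl; unfold mult; simpl.
    assert (RInt g 0 t0 <= RInt (fun _ => B) 0 t0).
    { apply RInt_le; [lra|apply Hex|apply ex_RInt_const|]. intros s Hs. apply HB. lra. }
    rewrite (RInt_const 0 t0 B) in H. unfold scal in H; simpl in H; unfold mult in H; simpl in H.
    lra.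
  - rewrite Rmin_left, Rmax_right by lra. intros s Hs. apply H0. lra.
Qed.

Lemma SiISS_JLC n k d sigma tauD a b a_lo a_hi b_lo :
  (1 <= k)%nat -> (1 <= d)%nat ->
  dwell_time sigma tauD ->
  (forall i j, (i < n)%nat -> (j < n)%nat -> weight_continuous n k d (a i j)) ->
  (forall i j, (i < n)%nat -> (j < k)%nat -> weight_continuous n k d (b i j)) ->
  0 < a_lo -> a_lo <= a_hi -> 0 < b_lo ->
  (forall i j x y t, (i < n)%nat -> (j < n)%nat -> a_lo <= a i j x y t <= a_hi) ->
  (forall i j x y t, (i < n)%nat -> (j < k)%nat -> b_lo <= b i j x y t) ->
  (forall t, 0 <= t -> forall i j, (i < n)%nat -> (j < n)%nat ->
     sigma t (FN i) (FN j) = sigma t (FN j) (FN i)) ->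
  SiISS n k d sigma a b -> JLC n k sigma.
Proof.
  intros Hk Hd (Htau & s & Hs0 & Hs & Hsig) Hac Hbc Ha Hah Hb Hab Hbb Hbi
    (beta & gamma & (_ & Hbeta) & (Hg0 & Hgi & Hgc) & Hiss) t1 Ht1 i0 Hi0.
  apply NNPP. intros Hno.
  set (reached := fun i => exists j, (j < k)%nat /\
    clos_trans node (joint_arc n k sigma (fun s => t1 <= s)) (LN j) (FN i)).
  change (~ reached i0) in Hno.
  destruct (dwell_partition_unbounded s tauD Htau Hs0 Hs) as [Hspos Hsunb].
  (* Waiting for a switching time lets the backward construction use whole dwell intervals. *)
  destruct (Hsunb t1) as [m0 Hm0]. set (t0 := s m0) in *.
  assert (Ht0 : 0 <= t0) by apply Hspos.
  set (c := fun i => if excluded_middle_informative (reached i) then 0 else 1).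
  assert (Hspread : forall t i j, t0 <= t -> (i < n)%nat -> (j < n)%nat ->
    sigma t (FN j) (FN i) = true -> reached j -> reached i).
  { intros t i j Ht Hi Hj E (l & Hl & Hp). exists l. split; [exact Hl|].
    apply t_trans with (FN j); [exact Hp|]. apply t_step.
    split; [exact Hj|split; [exact Hi|]]. exists t. split; [lra|exact E]. }
  destruct (solution_to_equilibrium n k d a b a_lo a_hi b_lo sigma s m0 c) as (r & Hr & Hsol); auto.
  { intros m. specialize (Hs m). lra. }
  (* An arc between a reached and an unreached follower could be traversed in the direction that
     reaches the latter; so neighbours share the value of [c], at every scale [r]. *)
  { intros i t r Hi Ht. fold t0 in Ht. apply axis_rhs_equilibrium.
    - intros j Hj E. f_equal. unfold c.
      assert (E' : sigma t (FN i) (FN j) = true) by (rewrite Hbi; auto; lra).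
      destruct (excluded_middle_informative (reached j)) as [R|R],
        (excluded_middle_informative (reached i)) as [R'|R']; auto; exfalso.
      + apply R'. apply (Hspread t i j); auto.
      + apply R. apply (Hspread t j i); auto.
    - intros j Hj E. unfold c. destruct (excluded_middle_informative (reached i)) as [R|R]; [ring|].
      exfalso. apply R. exists j. split; [exact Hj|]. apply t_step.
      split; [exact Hj|split; [exact Hi|]]. exists t. split; [lra|exact E]. }
  { intros i _. unfold c. destruct (excluded_middle_informative (reached i)); lra. }
  (* With [gamma (z t)] at most this value on [[0, t0]] and zero later, the integral stays below
     [r / 2] at all times. *)
  destruct (Hgc 0 (r / (2 * (t0 + 1)))) as (dl & Hdl & Hgam); [lra|apply Rdiv_lt_0_compat; lra|].
  pose proof (pos_INR n) as Hn.
  set (eps := Rmin r (dl / (2 * (INR n + 1)))).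
  assert (He : 0 < eps) by (apply Rmin_pos; [lra|apply Rdiv_lt_0_compat; lra]).
  destruct (Hsol eps (conj He (Rmin_l _ _))) as (xi & e & Hw & Hode & Heq & Hsmall).
  fold t0 in Heq, Hsmall.
  set (z := fun t => sqrt (sumR n (fun i => e t i ^ 2))).
  assert (Hz0 : forall t, 0 <= z t) by (intros; apply sqrt_pos).
  assert (Hgnn : forall q, 0 <= q -> 0 <= gamma q).
  { intros q [Hq|<-]; [|lra]. rewrite <- Hg0. left. apply Hgi; lra. }
  assert (Hzeps : forall t, 0 <= t <= t0 -> gamma (z t) <= r / (2 * (t0 + 1))).
  { intros t Ht.
    assert (Hzle : z t < dl).
    { apply Rle_lt_trans with (INR n * eps).
      - unfold z. rewrite <- (sqrt_pow2 (INR n * eps)) by (apply Rmult_le_pos; lra).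
        apply sqrt_le_1_alt. apply Rle_trans with (INR n * eps ^ 2).
        + rewrite <- sumR_const. apply sumR_le. intros i Hi.
          rewrite <- pow2_abs. apply pow_incr. split; [apply Rabs_pos|auto].
        + destruct n as [|n']; [lia|]. rewrite S_INR in *. pose proof (pos_INR n'). nra.
      - assert (eps <= dl / (2 * (INR n + 1))) by apply Rmin_r.
        assert (INR n * eps <= INR n * (dl / (2 * (INR n + 1)))) by (apply Rmult_le_compat_l; lra).
        assert (2 * (INR n + 1) * (dl / (2 * (INR n + 1))) = dl) by (field; lra).
        assert (0 < dl / (2 * (INR n + 1))) by (apply Rdiv_lt_0_compat; lra). nra. }
    specialize (Hgam (z t) (Hz0 t)). rewrite Hg0, !Rminus_0_r in Hgam.
    rewrite !Rabs_pos_eq in Hgam; auto. left. auto. }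
  assert (Hzt : forall t, t0 <= t -> z t = 0).
  { intros t Ht. unfold z. rewrite sumR_zero; [apply sqrt_0|].
    intros i Hi. rewrite (proj2 (Heq t i Ht Hi)). ring. }
  assert (Hzc : continuity (fun t => gamma (z t))).
  { intros t. apply (continuity_pt_ext (fun t => gamma (Rmax 0 (z t)))).
    { intros u. rewrite Rmax_right; auto. }
    apply (continuity_pt_comp z (fun q => gamma (Rmax 0 q))); [|apply cont_nonneg_extend, Hgc].
    apply (continuity_pt_comp (fun t => sumR n (fun i => e t i ^ 2)) sqrt).
    - apply (continuity_pt_sumR n (fun i t => e t i ^ 2)). intros i Hi.
      apply (continuity_pt_ext (fun t => e t i * e t i)); [intros; simpl; ring|].
      apply continuity_pt_mult; apply (Hw i O Hi Hd).
    - apply continuity_pt_sqrt. apply sumR_nonneg. intros; apply pow2_ge_0. }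
  set (sd0 := set_dist n k d (on_first_axis (xi 0)) origin).
  (* The trajectory is already fixed, so the time after which [beta] is below [r / 2] may depend on
     its initial distance [sd0]. The two halves then stay strictly below the persisting distance
     [r]. *)
  destruct (proj2 (Hbeta sd0 (maxR_nonneg _ _)) (r / 2)) as [T HT]; [lra|].
  set (t := Rmax t0 T).
  assert (Htt0 : t0 <= t) by apply Rmax_l.
  assert (Hex : ex_RInt (fun q => gamma (znorm n k d no_input (axis_input e) (fun _ => origin) q)) 0 t).
  { apply (ex_RInt_ext (fun q => gamma (z q))).
    - intros q _. unfold z. now rewrite znorm_axis.
    - apply (ex_RInt_continuous (fun q => gamma (z q)) 0 t). intros q _.
      apply continuity_pt_filterlim, Hzc. }
  specialize (Hiss no_input (axis_input e) (fun t => on_first_axis (xi t)) (fun _ => origin)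
    (fun j _ => admissible_no_input k d j) Hw Hode t ltac:(lra) (ex_RInt_Reals_0 _ _ _ Hex)).
  rewrite <- RInt_Reals in Hiss.
  rewrite (RInt_ext _ (fun q => gamma (z q))) in Hiss
    by (intros q _; unfold z; now rewrite znorm_axis).
  assert (HI : RInt (fun q => gamma (z q)) 0 t <= r / (2 * (t0 + 1)) * t0).
  { apply integral_of_vanishing_tail; auto.
    intros q Hq. now rewrite Hzt. }
  assert (HI2 : r / (2 * (t0 + 1)) * t0 < r / 2).
  { assert (0 < r / (2 * (t0 + 1))) by (apply Rdiv_lt_0_compat; lra).
    assert (r / (2 * (t0 + 1)) * (t0 + 1) = r / 2) by (field; lra). lra. }
  assert (Hlow : r <= set_dist n k d (on_first_axis (xi t)) origin).
  { eapply Rle_trans; [|apply (set_dist_on_axis n k d (xi t) i0); auto].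
    rewrite (proj1 (Heq t i0 Htt0 Hi0)). unfold c.
    destruct (excluded_middle_informative (reached i0)); [tauto|lra]. }
  specialize (HT t (Rmax_r _ _)). fold sd0 in Hiss. lra.
Qed.

Theorem theorem3 (n k d : nat) (P : list digraph) (sigma : R -> digraph) (tauD : R)
  (a b : nat -> nat -> Vecs -> Vecs -> R -> R) (a_lo a_hi b_lo : R) :
  (2 <= n)%nat -> (1 <= k)%nat -> (1 <= d)%nat ->
  (forall t, 0 <= t -> In (sigma t) P) ->
  (forall G, In G P -> forall v j, valid_node n k v -> (j < k)%nat -> G v (LN j) = false) ->
  dwell_time sigma tauD ->
  (forall i j, (i < n)%nat -> (j < n)%nat -> weight_continuous n k d (a i j)) ->
  (forall i j, (i < n)%nat -> (j < k)%nat -> weight_continuous n k d (b i j)) ->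
  0 < a_lo -> a_lo <= a_hi -> 0 < b_lo ->
  (forall i j x y t, (i < n)%nat -> (j < n)%nat -> a_lo <= a i j x y t <= a_hi) ->
  (forall i j x y t, (i < n)%nat -> (j < k)%nat -> b_lo <= b i j x y t) ->
  (forall t, 0 <= t -> forall i j, (i < n)%nat -> (j < n)%nat ->
     sigma t (FN i) (FN j) = sigma t (FN j) (FN i)) ->
  (SiISS n k d sigma a b <-> JLC n k sigma).
Proof.
  intros _ Hk Hd HP HG Hdwell Hac Hbc Ha Hah Hb Hab Hbb Hbi. split.
  - apply (SiISS_JLC n k d sigma tauD a b a_lo a_hi b_lo); auto.
  - apply (JLC_SiISS n k d sigma tauD a b a_lo a_hi b_lo); auto.
Qed.
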